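(* Let $Q=\mathrm{Emb}(S^1,\mathbb R^2)$ with the reparametrization action of $G=\mathrm{Diff}^+(S^1)$, and consider the hyperbolic curvature flow Lagrangian $$L:TQ\to\mathbb R,\qquad L(c,c_t)=\int_{S^1}\left(\tfrac12\|c_t\|^2-1\right)dl,$$ split, for $c_t=h\,\mathbf n+v\,\mathbf t$, as $L=L^h+L^v$ with $$L^h=\int_{S^1}\left(\tfrac12h^2-1\right)dl,\qquad L^v=\int_{S^1}\tfrac12v^2\,dl .$$ Then the un-reduced equations of this system, with vertical force $F^v$, read $$\partial_th=D_\theta(vh)-\kappa\left(\tfrac12h^2-1\right),\qquad \partial_tv=F^v,\qquad c_t=h\,\mathbf n+v\,\mathbf t .$$ In particular, if $F^v=0$ and the initial tangent velocity vanishes ($v(0)=0$), then $v(t)=0$ for all times $t$ and the velocity of $h$ (that is, $\partial_th$) is proportional to the curvature $\kappa$.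
   Context: $\mathrm{Emb}(S^1,\mathbb R^2)$ is the manifold of (positively oriented) embeddings $c:S^1\to\mathbb R^2$, $\theta\mapsto c(\theta)$, with $T_cQ=C^\infty(S^1,\mathbb R^2)$; $c_t$ is the time derivative of a curve $t\mapsto c(t)\in Q$. $G$ acts on the right by reparametrization, with Lie algebra $\mathfrak g=\mathfrak X(S^1)$. $(\mathbf t,\mathbf n)$ is the orthonormal Frenet frame along $c$, $\mathbf t=c_\theta/|c_\theta|$, $\mathbf n=J\mathbf t$ (with $J\mathbf n=-\mathbf t$), $\kappa$ is the Frenet curvature, $dl=|c_\theta|d\theta$ is arc-length, and $D_\theta=\frac1{|c_\theta|}\partial_\theta$ is the arc-length derivative, so that $D_\theta\mathbf n=-\kappa\mathbf t$. The scalar functions $h,v$ along the curve are the normal and tangential components of $c_t$. The principal connection $\mathcal A$ on $Q\to Q/G$ is given by the splitting $TQ=HQ\oplus VQ$ in which the vertical part of $u\in T_cQ$ is $(u\cdot\mathbf t)\mathbf t$ and the horizontal part is $(u\cdot\mathbf n)\mathbf n$. The un-reduced equations (with parameter manifold $N=\mathbb R$, coordinate $t$, volume form $dt$) for the shape-space Lagrangian $l$ on $T(Q/G)$ obtained by projecting $L^h$ are $$\mathcal{EL}(L^h)=0,\qquad \mathcal A^*\,\frac{d}{dt}\left(\mathbf J\left(\frac{\delta L^v}{\delta c_t}\right)\right)=F^v,$$ where $\mathcal{EL}(L^h)=\frac{\partial L^h}{\partial c}-\frac{d}{dt}\frac{\partial L^h}{\partial c_t}$ is the Euler-Lagrange form,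 $\mathbf J:T^*Q\to\mathfrak g^*$ is the momentum map $\langle\mathbf J(\alpha_c),\xi\rangle=\langle\alpha_c,\xi_Q(c)\rangle$ ($\xi_Q$ being the infinitesimal generator of $\xi\in\mathfrak g$), $\mathcal A^*:\mathfrak g^*\to V^*Q$ is the dual of the connection form, and $F^v:TQ\to V^*Q$ is an arbitrary $G$-equivariant vertical force. Covectors are written through scalar functions along the curve (the normal coefficient for the first equation, the tangential one for the second), pairing with scalar components of variations via $\int_{S^1}\cdot\,dl$.
   Formalization: d/dt of a covector (and of J) acts only on the scalar coefficient along the curve; dl and |c_θ| are not differentiated. With the usual d/dt the h-equation fails: concentric circles (v=0) give ∂_t h=κ(1+h²/2). *)

(* Defs.v *)
From Stdlib Require Import Reals ZArith.
From Coquelicot Require Import Coquelicot.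
Open Scope R_scope.

(** S^1 is R / 2 pi Z: objects on S^1 are 2 pi-periodic functions of theta. *)

Definition plane : Type := (R * R)%type.
Definition field : Type := R -> plane.

Definition dot (p q : plane) : R := fst p * fst q + snd p * snd q.
Definition norm2 (p : plane) : R := sqrt (dot p p).
Definition add (p q : plane) : plane := (fst p + fst q, snd p + snd q).
Definition scal2 (a : R) (p : plane) : plane := (a * fst p, a * snd p).
Definition rotJ (p : plane) : plane := (- snd p, fst p).

Definition smooth (f : R -> R) : Prop := forall n x, ex_derive_n f n x.

Definition smooth_circle (f : R -> R) : Prop :=
  smooth f /\ forall x, f (x + 2 * PI) = f x.

(** C^oo(S^1, R^2), the model space of Q and each of its tangent spaces. *)
Definition smooth_field (u : field) : Prop :=
  smooth_circle (fun x => fst (u x)) /\ smooth_circle (fun x => snd (u x)).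

Definition d_theta (u : field) : field :=
  fun x => (Derive (fun y => fst (u y)) x, Derive (fun y => snd (u y)) x).

(** An injective immersion of the compact S^1 is an embedding; the last
    condition says that the signed area enclosed by c is positive. *)
Definition Emb (c : field) : Prop :=
  smooth_field c /\
  (forall x, d_theta c x <> (0, 0)) /\
  (forall x y, c x = c y -> exists k : Z, y = x + 2 * PI * IZR k) /\
  0 < RInt (fun x => dot (rotJ (c x)) (d_theta c x)) 0 (2 * PI).

(** Lifts to R of the elements of Diff^+(S^1). *)
Definition Diff_plus (phi : R -> R) : Prop :=
  smooth phi /\ (forall x, phi (x + 2 * PI) = phi x + 2 * PI) /\
  (forall x, 0 < Derive phi x).

Definition speed (c : field) (x : R) : R := norm2 (d_theta c x).
Definition tangent (c : field) : field :=
  fun x => scal2 (/ speed c x) (d_theta c x).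
Definition normal (c : field) : field := fun x => rotJ (tangent c x).

Definition int_dl (c : field) (f : R -> R) : R :=
  RInt (fun x => f x * speed c x) 0 (2 * PI).

Definition D_arc (c : field) (f : R -> R) (x : R) : R := Derive f x / speed c x.

(** Frenet: D_theta t = kappa n, equivalently D_theta n = - kappa t. *)
Definition curvature (c : field) (x : R) : R :=
  dot (scal2 (/ speed c x) (d_theta (tangent c) x)) (normal c x).

Definition n_comp (c u : field) (x : R) : R := dot (u x) (normal c x).
Definition t_comp (c u : field) (x : R) : R := dot (u x) (tangent c x).

(** Functions on TQ are given on pairs (c, u) with [Emb c] and
    [smooth_field u]; values at other pairs are irrelevant. *)
Definition Lagrangian : Type := field -> field -> R.

Definition L_hcf : Lagrangian := fun c u =>
  int_dl c (fun x => / 2 * norm2 (u x) ^ 2 - 1).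
Definition L_h : Lagrangian := fun c u =>
  int_dl c (fun x => / 2 * n_comp c u x ^ 2 - 1).
Definition L_v : Lagrangian := fun c u =>
  int_dl c (fun x => / 2 * t_comp c u x ^ 2).

(** Covectors, as functionals; only their values on smooth fields (resp. on
    vertical fields, for elements of V*Q) matter. *)
Definition covector : Type := field -> R.

(** Partial derivatives in the trivialization TQ = Q x C^oo(S^1, R^2):
    [dL_dc] varies c with the R^2-valued function u = c_t held fixed. *)
Definition dL_dc (L : Lagrangian) (c u : field) : covector := fun w =>
  Derive (fun e => L (fun x => add (c x) (scal2 e (w x))) u) 0.
Definition dL_dct (L : Lagrangian) (c u : field) : covector := fun w =>
  Derive (fun e => L c (fun x => add (u x) (scal2 e (w x)))) 0.

(** Joint smoothness on D x R, for D open. *)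
Fixpoint Ck2 (D : R -> Prop) (k : nat) (f : R -> R -> R) : Prop :=
  (forall t x, D t -> continuity_2d_pt f t x) /\
  match k with
  | O => True
  | S m =>
      (forall t x, D t -> ex_derive (fun s => f s x) t /\ ex_derive (f t) x) /\
      Ck2 D m (fun t x => Derive (fun s => f s x) t) /\
      Ck2 D m (fun t x => Derive (f t) x)
  end.

Definition smooth2 (D : R -> Prop) (f : R -> R -> R) : Prop :=
  forall k, Ck2 D k f.

Definition time_interval (a b : Rbar) (t : R) : Prop := Rbar_lt a t /\ Rbar_lt t b.

(** Smooth curves t |-> c(t) in Q, for t in D. *)
Definition curve_in_Emb (D : R -> Prop) (c : R -> field) : Prop :=
  smooth2 D (fun t x => fst (c t x)) /\ smooth2 D (fun t x => snd (c t x)) /\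
  forall t, D t -> Emb (c t).

Definition d_t (c : R -> field) (t : R) : field :=
  fun x => (Derive (fun s => fst (c s x)) t, Derive (fun s => snd (c s x)) t).

Definition d_t_ex (c : R -> field) (t : R) : Prop :=
  forall x, ex_derive (fun s => fst (c s x)) t /\ ex_derive (fun s => snd (c s x)) t.

(** beta = d alpha / dt along c.  Covectors at c are identified with fields
    along c through the pairing given by the integral of p . w dl, and d/dt
    acts on the field p.  The arc-length density dl at time t belongs to the
    pairing and is NOT differentiated: if p represents alpha, then
    beta = int (d_t p . w) dl, which for p = h n has normal coefficient d_t h
    (and not d_t h + h d_t|c_theta| / |c_theta|). *)
Definition is_ddt_covector (D : R -> Prop) (c : R -> field)
    (alpha beta : R -> covector) : Prop :=
  exists p : R -> field,
    (forall t, D t -> smooth_field (p t) /\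
       forall w, smooth_field w ->
         alpha t w = int_dl (c t) (fun x => dot (p t x) (w x))) /\
    (forall t, D t -> d_t_ex p t /\
       forall w, smooth_field w ->
         beta t w = int_dl (c t) (fun x => dot (d_t p t x) (w x))).

(** e is the Euler-Lagrange form dL/dc - d/dt (dL/dc_t) along c. *)
Definition is_EL (D : R -> Prop) (L : Lagrangian) (c : R -> field)
    (e : R -> covector) : Prop :=
  exists beta : R -> covector,
    is_ddt_covector D c (fun t => dL_dct L (c t) (d_t c t)) beta /\
    forall t w, D t -> smooth_field w ->
      e t w = dL_dc L (c t) (d_t c t) w - beta t w.

(** A vector field xi(theta) d/dtheta on S^1 is given by the function xi, and
    elements of g* are functionals on such functions. *)
Definition generator (c : field) (xi : R -> R) : field :=
  fun x => scal2 (xi x) (d_theta c x).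

Definition gstar : Type := (R -> R) -> R.

Definition momentum_map (c : field) (alpha : covector) : gstar :=
  fun xi => alpha (generator c xi).

Definition vertical_part (c u : field) : field :=
  fun x => scal2 (t_comp c u x) (tangent c x).

Definition vertical (c u : field) : Prop :=
  smooth_field u /\ forall x, u x = vertical_part c u x.

(** The xi whose infinitesimal generator at c is [vertical_part c u]. *)
Definition connection (c u : field) : R -> R := fun x => t_comp c u x / speed c x.

Definition connection_dual (c : field) (mu : gstar) : covector :=
  fun u => mu (connection c u).

(** nu = d mu / dt for a curve in g*.  With the convention of
    [is_ddt_covector], mu is written through the function m along c that it
    pairs, by integration against dl, with the (tangential) scalar component
    |c_theta| xi of the infinitesimal generator of xi; d/dt acts on m. *)
Definition is_ddt_gstar (D : R -> Prop) (c : R -> field)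
    (mu nu : R -> gstar) : Prop :=
  exists m : R -> R -> R,
    (forall t, D t -> smooth_circle (m t) /\
       forall xi, smooth_circle xi ->
         mu t xi =
           int_dl (c t) (fun x => m t x * t_comp (c t) (generator (c t) xi) x)) /\
    (forall t, D t -> (forall x, ex_derive (fun s => m s x) t) /\
       forall xi, smooth_circle xi ->
         nu t xi =
           int_dl (c t) (fun x => Derive (fun s => m s x) t *
                                  t_comp (c t) (generator (c t) xi) x)).

(** A G-equivariant vertical force F^v : TQ -> V*Q, given by the tangential
    coefficient of F^v(c, u) with respect to dl. *)
Record vertical_force : Type := VerticalForce {
  force_coeff : field -> field -> R -> R;
  force_smooth : forall c u, Emb c -> smooth_field u ->
    smooth_circle (force_coeff c u);
  force_equivariant : forall c u phi,
    Emb c -> smooth_field u -> Diff_plus phi ->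
    forall x, force_coeff (fun y => c (phi y)) (fun y => u (phi y)) x
              = force_coeff c u (phi x)
}.

Definition force (F : vertical_force) (c u : field) : covector :=
  fun w => int_dl c (fun x => force_coeff F c u x * t_comp c w x).

(** EL(L^h) = 0  and  A^* d/dt (J (dL^v / dc_t)) = F^v. *)
Definition unreduced_equations (D : R -> Prop) (Lh Lv : Lagrangian)
    (F : vertical_force) (c : R -> field) : Prop :=
  is_EL D Lh c (fun _ _ => 0) /\
  exists nu : R -> gstar,
    is_ddt_gstar D c
      (fun t => momentum_map (c t) (dL_dct Lv (c t) (d_t c t))) nu /\
    forall t w, D t -> vertical (c t) w ->
      connection_dual (c t) (nu t) w = force F (c t) (d_t c t) w.

Definition h_comp (c : R -> field) (t x : R) : R := n_comp (c t) (d_t c t) x.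
Definition v_comp (c : R -> field) (t x : R) : R := t_comp (c t) (d_t c t) x.

(* Main.v *)
Require Import Defs.
From Stdlib Require Import Reals ZArith Lra Psatz.
From Coquelicot Require Import Coquelicot.
Open Scope R_scope.

(** Everything is expressed in the moving frame [(t, n)].  When a plane vector
    [q] moves with velocity [d], its direction [q / |q|] turns at the rate
    [(d . n) / |q|] and its length grows at the rate [d . t]
    ([is_derive_direction], [is_derive_norm2]).  Applied to [c_theta], this gives
    the Frenet equation (parameter [theta]), the evolution of the frame along a
    curve of curves (parameter [t], by equality of mixed derivatives) and the
    variation of the frame and of the arc length when [c] is replaced by
    [c + e w] (parameter [e]).

    Write [u = c_t = h n + v t].  The fibre derivative of [L_h] is represented
    by the field [h n], that of [L_v] by [v t].  Differentiating [L_h] in [c]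
    under the integral sign gives
    [int (- h v (w_theta . n) + (h^2 / 2 - 1) (w_theta . t)) dtheta], and
    integrating by parts with the Frenet equation turns it into
    [int (D(v h) - kappa (h^2 / 2 - 1)) (w . n) - h (n . D u) (w . t) dl]
    ([dL_dc_L_h]).  On the other hand [(h n)_t = h_t n - h (n . D u) t], since
    the frame rotates at the rate [n . D u].  The tangential parts cancel, so
    the Euler-Lagrange covector of [L_h] is the purely normal
    [D(v h) - kappa (h^2 / 2 - 1) - h_t] ([EL_L_h]).  The vertical equation
    reads [v_t = F], because a generator [xi c_theta] has tangential
    component [|c_theta| xi], which the connection undoes
    ([vertical_equation_iff]).

    Passing between covectors and functions needs the uniqueness of the
    representing function.  All representing functions here are smooth, so the
    difference of two of them serves as its own test function
    ([covector_representative_unique], [function_representative_unique]);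
    smoothness in [theta] of the time
    derivatives involved comes from the explicit formulas for [h_t] and [v_t].

    If the force vanishes, then [v_t = 0], so [v] stays zero and the term
    [D(v h)] drops out of the first equation. *)

(** * Smooth functions on the circle *)

(** The inductive description of differentiability classes (differentiable,
    with derivative in the previous class) is the one in which the product,
    quotient and square-root rules become closure properties by induction. *)
Fixpoint differentiable_upto (n : nat) (f : R -> R) : Prop :=
  match n with
  | O => True
  | S m => (forall x, ex_derive f x) /\ differentiable_upto m (Derive f)
  end.

Lemma Derive_n_Derive (f : R -> R) (n : nat) (x : R) :
  Derive_n (Derive f) n x = Derive_n f (S n) x.
Proof.
  change (Derive f) with (Derive_n f 1).
  rewrite Derive_n_comp. now rewrite Nat.add_1_r.
Qed.

Lemma smooth_Derive (f : R -> R) : smooth f -> smooth (Derive f).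
Proof.
  intros Hf [|n] x; [exact I|].
  apply (ex_derive_ext (Derive_n f (S n))).
  - intros y. symmetry. apply Derive_n_Derive.
  - exact (Hf (S (S n)) x).
Qed.

Lemma smooth_ex_derive (f : R -> R) (x : R) : smooth f -> ex_derive f x.
Proof. intros Hf. exact (Hf 1%nat x). Qed.

Lemma smooth_differentiable_upto (f : R -> R) :
  smooth f <-> forall n, differentiable_upto n f.
Proof.
  split.
  - intros Hf n. revert f Hf. induction n as [|n IH]; intros f Hf; [exact I|].
    split; [intros x; now apply smooth_ex_derive|].
    apply IH. now apply smooth_Derive.
  - intros Hf n. revert f Hf. induction n as [|n IH]; intros f Hf x; [exact I|].
    destruct n as [|n]; [exact (proj1 (Hf 1%nat) x)|].
    apply (ex_derive_ext (Derive_n (Derive f) n)).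
    + intros y. apply Derive_n_Derive.
    + apply (IH (Derive f)). intros m. exact (proj2 (Hf (S m))).
Qed.

Lemma differentiable_upto_ext (n : nat) (f g : R -> R) :
  (forall x, f x = g x) -> differentiable_upto n f -> differentiable_upto n g.
Proof.
  revert f g. induction n as [|n IH]; intros f g E H; [exact I|].
  destruct H as [H0 H1]. split.
  - intros x. now apply (ex_derive_ext f).
  - apply (IH (Derive f)); [|exact H1]. intros x. now apply Derive_ext.
Qed.

Lemma differentiable_upto_pred (n : nat) (f : R -> R) :
  differentiable_upto (S n) f -> differentiable_upto n f.
Proof.
  revert f. induction n as [|n IH]; intros f [H0 H1]; [exact I|].
  split; [exact H0|]. now apply IH.
Qed.

Lemma differentiable_upto_plus (n : nat) (f g : R -> R) :
  differentiable_upto n f -> differentiable_upto n g ->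
  differentiable_upto n (fun x => f x + g x).
Proof.
  revert f g. induction n as [|n IH]; intros f g Hf Hg; [exact I|].
  destruct Hf as [F0 F1], Hg as [G0 G1]. split.
  - intros x. now apply @ex_derive_plus.
  - apply (differentiable_upto_ext n (fun x => Derive f x + Derive g x)).
    + intros x. symmetry. now apply Derive_plus.
    + now apply IH.
Qed.

Lemma differentiable_upto_mult (n : nat) (f g : R -> R) :
  differentiable_upto n f -> differentiable_upto n g ->
  differentiable_upto n (fun x => f x * g x).
Proof.
  revert f g. induction n as [|n IH]; intros f g Hf Hg; [exact I|].
  assert (Hf' := differentiable_upto_pred n f Hf).
  assert (Hg' := differentiable_upto_pred n g Hg).
  destruct Hf as [F0 F1], Hg as [G0 G1]. split.
  - intros x. now apply ex_derive_mult.
  - apply (differentiable_upto_ext n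
      (fun x => Derive f x * g x + f x * Derive g x)).
    + intros x. symmetry. now apply Derive_mult.
    + apply differentiable_upto_plus; now apply IH.
Qed.

Lemma differentiable_upto_const (n : nat) (k : R) :
  differentiable_upto n (fun _ => k).
Proof.
  revert k. induction n as [|n IH]; intros k; [exact I|]. split.
  - intros x. apply ex_derive_const.
  - apply (differentiable_upto_ext n (fun _ => 0)); [|apply IH].
    intros x. symmetry. apply Derive_const.
Qed.

Lemma differentiable_upto_inv (n : nat) (f : R -> R) :
  (forall x, f x <> 0) -> differentiable_upto n f ->
  differentiable_upto n (fun x => / f x).
Proof.
  intros Hnz. revert f Hnz. induction n as [|n IH]; intros f Hnz Hf; [exact I|].
  assert (Hf' := differentiable_upto_pred n f Hf).
  destruct Hf as [F0 F1]. split.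
  - intros x. now apply ex_derive_inv.
  - apply (differentiable_upto_ext n
      (fun x => (-1 * Derive f x) * (/ f x * / f x))).
    + intros x. rewrite Derive_inv by auto. field. auto.
    + apply differentiable_upto_mult; apply differentiable_upto_mult; auto.
      apply differentiable_upto_const.
Qed.

Lemma differentiable_upto_sqrt (n : nat) (f : R -> R) :
  (forall x, 0 < f x) -> differentiable_upto n f ->
  differentiable_upto n (fun x => sqrt (f x)).
Proof.
  intros Hpos. revert f Hpos.
  induction n as [|n IH]; intros f Hpos Hf; [exact I|].
  assert (Hf' := differentiable_upto_pred n f Hf).
  destruct Hf as [F0 F1].
  assert (Hs : forall x, is_derive (fun x => sqrt (f x)) x
                           (Derive f x / (2 * sqrt (f x)))).
  { intros x. apply is_derive_sqrt; [|apply Hpos].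
    now apply Derive_correct. }
  split.
  - intros x. eexists. apply Hs.
  - apply (differentiable_upto_ext n
      (fun x => Derive f x * / (2 * sqrt (f x)))).
    + intros x. symmetry. apply is_derive_unique. apply Hs.
    + apply differentiable_upto_mult; auto.
      apply differentiable_upto_inv.
      * intros x. generalize (sqrt_lt_R0 (f x) (Hpos x)). lra.
      * apply differentiable_upto_mult; [apply differentiable_upto_const|].
        now apply IH.
Qed.

Lemma smooth_circle_ext (f g : R -> R) :
  (forall x, f x = g x) -> smooth_circle f -> smooth_circle g.
Proof.
  intros E [S P]. split.
  - apply smooth_differentiable_upto. intros n.
    apply (differentiable_upto_ext n f g E). now apply smooth_differentiable_upto.
  - intros x. rewrite <- !E. apply P.
Qed.

Lemma smooth_circle_const (k : R) : smooth_circle (fun _ => k).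
Proof.
  split; [|reflexivity].
  apply smooth_differentiable_upto. intros n. apply differentiable_upto_const.
Qed.

Lemma smooth_circle_plus (f g : R -> R) :
  smooth_circle f -> smooth_circle g -> smooth_circle (fun x => f x + g x).
Proof.
  intros [Sf Pf] [Sg Pg]. split.
  - apply smooth_differentiable_upto. intros n.
    apply differentiable_upto_plus; now apply smooth_differentiable_upto.
  - intros x. now rewrite Pf, Pg.
Qed.

Lemma smooth_circle_mult (f g : R -> R) :
  smooth_circle f -> smooth_circle g -> smooth_circle (fun x => f x * g x).
Proof.
  intros [Sf Pf] [Sg Pg]. split.
  - apply smooth_differentiable_upto. intros n.
    apply differentiable_upto_mult; now apply smooth_differentiable_upto.
  - intros x. now rewrite Pf, Pg.
Qed.

Lemma smooth_circle_opp (f : R -> R) :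
  smooth_circle f -> smooth_circle (fun x => - f x).
Proof.
  intros Hf. apply (smooth_circle_ext (fun x => -1 * f x)); [intros x; ring|].
  now apply smooth_circle_mult; [apply smooth_circle_const|].
Qed.

Lemma smooth_circle_minus (f g : R -> R) :
  smooth_circle f -> smooth_circle g -> smooth_circle (fun x => f x - g x).
Proof.
  intros Hf Hg. apply smooth_circle_plus; [exact Hf|].
  now apply smooth_circle_opp.
Qed.

Lemma smooth_circle_inv (f : R -> R) :
  (forall x, f x <> 0) -> smooth_circle f -> smooth_circle (fun x => / f x).
Proof.
  intros Hnz [Sf Pf]. split.
  - apply smooth_differentiable_upto. intros n.
    apply differentiable_upto_inv; [exact Hnz|].
    now apply smooth_differentiable_upto.
  - intros x. now rewrite Pf.
Qed.

Lemma smooth_circle_sqrt (f : R -> R) :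
  (forall x, 0 < f x) -> smooth_circle f -> smooth_circle (fun x => sqrt (f x)).
Proof.
  intros Hpos [Sf Pf]. split.
  - apply smooth_differentiable_upto. intros n.
    apply differentiable_upto_sqrt; [exact Hpos|].
    now apply smooth_differentiable_upto.
  - intros x. now rewrite Pf.
Qed.

Lemma smooth_circle_pow (f : R -> R) (n : nat) :
  smooth_circle f -> smooth_circle (fun x => f x ^ n).
Proof.
  intros Hf. induction n as [|n IH]; simpl.
  - apply smooth_circle_const.
  - now apply smooth_circle_mult.
Qed.

Lemma smooth_circle_Derive (f : R -> R) :
  smooth_circle f -> smooth_circle (Derive f).
Proof.
  intros [Sf Pf]. split; [now apply smooth_Derive|].
  intros x.
  rewrite <- (Derive_ext (fun y => f (y + 2 * PI)) f x Pf).
  symmetry. apply is_derive_unique.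
  replace (Derive f (x + 2 * PI)) with (scal 1 (Derive f (x + 2 * PI)))
    by (apply Rmult_1_l).
  apply (is_derive_comp f (fun y => y + 2 * PI)).
  - apply Derive_correct. now apply smooth_ex_derive.
  - auto_derive; [exact I|ring].
Qed.

Lemma smooth_circle_is_derive (f : R -> R) (x : R) :
  smooth_circle f -> is_derive f x (Derive f x).
Proof.
  intros [Sf _]. apply Derive_correct. now apply smooth_ex_derive.
Qed.

Lemma smooth_circle_continuous (f : R -> R) (x : R) :
  smooth_circle f -> continuous f x.
Proof.
  intros Hf. apply (ex_derive_continuous (V := R_NormedModule)).
  eexists. now apply smooth_circle_is_derive.
Qed.

Lemma smooth_circle_ex_RInt (f : R -> R) (a b : R) :
  smooth_circle f -> ex_RInt f a b.
Proof.
  intros Hf. apply (ex_RInt_continuous (V := R_CompleteNormedModule)).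
  intros x _. now apply smooth_circle_continuous.
Qed.

Create HintDb smooth.
#[export] Hint Resolve smooth_circle_const smooth_circle_plus smooth_circle_mult
  smooth_circle_opp smooth_circle_minus smooth_circle_pow smooth_circle_Derive
  smooth_circle_is_derive : smooth.

Lemma RInt_Derive_circle (f : R -> R) :
  smooth_circle f -> RInt (Derive f) 0 (2 * PI) = 0.
Proof.
  intros Hf. rewrite RInt_Derive.
  - destruct Hf as [_ Pf]. apply Rminus_diag_eq.
    rewrite <- (Rplus_0_l (2 * PI)). apply Pf.
  - intros x _. destruct Hf as [Sf _]. now apply smooth_ex_derive.
  - intros x _. apply smooth_circle_continuous. now apply smooth_circle_Derive.
Qed.

(** A primitive [G] is nondecreasing and, its increment over a period being
    zero everywhere, constant on every interval of length less than a period;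
    hence its derivative vanishes.  Arguing with periods rather than on
    [[0, 2 PI]] avoids treating the end points separately. *)
Lemma nonneg_RInt_zero (g : R -> R) :
  smooth_circle g -> (forall x, 0 <= g x) -> RInt g 0 (2 * PI) = 0 ->
  forall x, g x = 0.
Proof.
  intros Hg Hpos Hint.
  pose (G := fun x => RInt (V := R_CompleteNormedModule) g 0 x : R).
  assert (HG : forall x, is_derive G x (g x)).
  { intros x. apply (is_derive_RInt g G 0 x).
    - apply filter_forall. intros y.
      apply (RInt_correct (V := R_CompleteNormedModule)).
      now apply smooth_circle_ex_RInt.
    - now apply smooth_circle_continuous. }
  assert (Hmono : forall x y, x <= y -> G x <= G y).
  { intros x y Hxy.
    assert (E : G x + RInt g x y = G y).
    { apply (RInt_Chasles (V := R_CompleteNormedModule) g 0 x y);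
        now apply smooth_circle_ex_RInt. }
    assert (0 <= RInt g x y).
    { apply RInt_ge_0; auto. now apply smooth_circle_ex_RInt. }
    lra. }
  assert (Hper : forall x, G (x + 2 * PI) = G x).
  { assert (Hd : forall x, is_derive (fun x => G (x + 2 * PI) - G x) x zero).
    { intros x.
      replace (@zero R_NormedModule) with (minus (scal 1 (g (x + 2 * PI))) (g x)).
      - apply (is_derive_minus (V := R_NormedModule)
                 (fun x => G (x + 2 * PI)) G); [|apply HG].
        apply (is_derive_comp G (fun y => y + 2 * PI)); [apply HG|].
        auto_derive; [exact I|ring].
      - rewrite (proj2 Hg x). 
        unfold minus, plus, opp, scal, zero; simpl. unfold mult; simpl. ring. }
    assert (H0 : G (0 + 2 * PI) - G 0 = 0).
    { rewrite Rplus_0_l. unfold G. rewrite Hint.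
      rewrite (RInt_point (V := R_CompleteNormedModule)). apply Rminus_0_r. }
    intros x.
    enough (G (x + 2 * PI) - G x = G (0 + 2 * PI) - G 0) by lra.
    destruct (Rtotal_order x 0) as [Hx|[->|Hx]].
    - apply (eq_is_derive (fun x => G (x + 2 * PI) - G x)); auto.
    - reflexivity.
    - symmetry. apply (eq_is_derive (fun x => G (x + 2 * PI) - G x)); auto. }
  intros x.
  assert (Hpi := PI_RGT_0).
  assert (Hloc : locally x (fun y => G x = G y)).
  { exists (mkposreal (2 * PI) ltac:(lra)). intros y Hy.
    assert (Hy' : Rabs (y - x) < 2 * PI) by exact Hy.
    apply Rabs_def2 in Hy'.
    assert (P1 := Hper x). assert (P2 := Hper y).
    destruct (Rle_dec x y) as [Hxy|Hxy].
    - assert (A := Hmono x y Hxy). assert (B := Hmono y (x + 2 * PI) ltac:(lra)).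
      lra.
    - assert (A := Hmono y x ltac:(lra)).
      assert (B := Hmono x (y + 2 * PI) ltac:(lra)). lra. }
  rewrite <- (is_derive_unique _ _ _ (HG x)).
  rewrite <- (Derive_ext_loc (fun _ => G x) G x Hloc). apply Derive_const.
Qed.

(** * Differential calculus of plane vectors *)

Definition is_derive_plane (q : R -> plane) (e : R) (d : plane) : Prop :=
  is_derive (fun s => fst (q s)) e (fst d) /\
  is_derive (fun s => snd (q s)) e (snd d).

Lemma is_derive_value (f : R -> R) (x l l' : R) :
  is_derive f x l -> l = l' -> is_derive f x l'.
Proof. now intros H <-. Qed.

Lemma is_derive_Rmult (f g : R -> R) (x df dg : R) :
  is_derive f x df -> is_derive g x dg ->
  is_derive (fun y => f y * g y) x (df * g x + f x * dg).
Proof.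
  intros Hf Hg. apply (is_derive_mult f g x df dg Hf Hg).
  intros n m. apply Rmult_comm.
Qed.

Lemma is_derive_Rplus (f g : R -> R) (x df dg : R) :
  is_derive f x df -> is_derive g x dg ->
  is_derive (fun y => f y + g y) x (df + dg).
Proof. intros Hf Hg. exact (is_derive_plus f g x df dg Hf Hg). Qed.

Lemma is_derive_Ropp (f : R -> R) (x df : R) :
  is_derive f x df -> is_derive (fun y => - f y) x (- df).
Proof. intros Hf. exact (is_derive_opp f x df Hf). Qed.

Lemma is_derive_plane_const (p : plane) (e : R) :
  is_derive_plane (fun _ => p) e (0, 0).
Proof. split; apply (is_derive_const (V := R_NormedModule)). Qed.

Lemma is_derive_rotJ (q : R -> plane) (e : R) (d : plane) :
  is_derive_plane q e d -> is_derive_plane (fun s => rotJ (q s)) e (rotJ d).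
Proof.
  intros [H1 H2]. split; simpl; [|exact H1]. now apply is_derive_Ropp.
Qed.

Lemma is_derive_scal2 (f : R -> R) (q : R -> plane) (e df : R) (d : plane) :
  is_derive f e df -> is_derive_plane q e d ->
  is_derive_plane (fun s => scal2 (f s) (q s)) e
    (add (scal2 df (q e)) (scal2 (f e) d)).
Proof. intros Hf [H1 H2]. split; simpl; now apply is_derive_Rmult. Qed.

Lemma is_derive_dot (p q : R -> plane) (e : R) (dp dq : plane) :
  is_derive_plane p e dp -> is_derive_plane q e dq ->
  is_derive (fun s => dot (p s) (q s)) e (dot dp (q e) + dot (p e) dq).
Proof.
  intros [P1 P2] [Q1 Q2]. unfold dot.
  eapply is_derive_value.
  - apply is_derive_Rplus; apply is_derive_Rmult; eassumption.
  - simpl. ring.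
Qed.

Lemma dot_self_pos (q : plane) : q <> (0, 0) -> 0 < dot q q.
Proof.
  destruct q as [a b]. intros Hq. unfold dot; simpl.
  destruct (Req_dec a 0) as [->|Ha].
  - destruct (Req_dec b 0) as [->|Hb]; [now elim Hq|]. nra.
  - nra.
Qed.

Lemma norm2_pos (q : plane) : q <> (0, 0) -> 0 < norm2 q.
Proof. intros Hq. apply sqrt_lt_R0. now apply dot_self_pos. Qed.

Lemma norm2_sqr (q : plane) : norm2 q * norm2 q = dot q q.
Proof.
  unfold norm2. apply sqrt_sqrt. unfold dot. nra.
Qed.

Definition direction (q : plane) : plane := scal2 (/ norm2 q) q.

Lemma dot_direction (q : plane) : q <> (0, 0) -> dot (direction q) (direction q) = 1.
Proof.
  intros Hq. assert (Hs := norm2_pos q Hq). assert (E := norm2_sqr q).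
  unfold direction, dot, scal2 in *; simpl in *.
  replace (/ norm2 q * fst q * (/ norm2 q * fst q) +
           / norm2 q * snd q * (/ norm2 q * snd q))
    with ((fst q * fst q + snd q * snd q) / (norm2 q * norm2 q))
    by (field; lra).
  rewrite <- E. field. lra.
Qed.

Lemma is_derive_norm2 (q : R -> plane) (e : R) (d : plane) :
  is_derive_plane q e d -> q e <> (0, 0) ->
  is_derive (fun s => norm2 (q s)) e (dot d (direction (q e))).
Proof.
  intros Hd Hq. assert (Hs := norm2_pos _ Hq). unfold norm2.
  eapply is_derive_value.
  - apply is_derive_sqrt.
    + apply is_derive_dot; exact Hd.
    + now apply dot_self_pos.
  - cbv beta. change (sqrt (dot (q e) (q e))) with (norm2 (q e)).
    unfold direction, dot, scal2; simpl. field. lra.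
Qed.

(** The direction of a moving vector turns at the rate given by the normal
    component of the velocity.  This one computation yields the Frenet equation
    (parameter [theta]), the evolution of the frame along a curve of curves
    (parameter [t]) and the variation of the frame under a variation of the
    curve. *)
Lemma is_derive_direction (q : R -> plane) (e : R) (d : plane) :
  is_derive_plane q e d -> q e <> (0, 0) ->
  is_derive_plane (fun s => direction (q s)) e
    (scal2 (dot d (rotJ (direction (q e))) / norm2 (q e)) (rotJ (direction (q e)))).
Proof.
  intros Hd Hq. assert (Hs := norm2_pos _ Hq). assert (E := norm2_sqr (q e)).
  assert (Hn := is_derive_norm2 q e d Hd Hq).
  assert (Hi : is_derive (fun s => / norm2 (q s)) e
                 (- dot d (direction (q e)) / norm2 (q e) ^ 2)).
  { apply (is_derive_inv _ _ _ Hn). lra. }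
  destruct (is_derive_scal2 _ _ _ _ _ Hi Hd) as [H1 H2].
  set (n := norm2 (q e)) in *. unfold dot in E.
  split; (eapply is_derive_value; [first [exact H1|exact H2]|]); fold n;
    unfold direction; fold n;
    unfold dot, scal2, rotJ; simpl.
  - replace (/ n * fst d) with (/ n ^ 3 * (n * n) * fst d) by (field; lra).
    rewrite E. field. lra.
  - replace (/ n * snd d) with (/ n ^ 3 * (n * n) * snd d) by (field; lra).
    rewrite E. field. lra.
Qed.

Lemma direction_frame (q p : plane) :
  q <> (0, 0) ->
  p = add (scal2 (dot p (rotJ (direction q))) (rotJ (direction q)))
          (scal2 (dot p (direction q)) (direction q)).
Proof.
  intros Hq. assert (E := dot_direction q Hq). revert E.
  generalize (direction q). intros [a b].
  destruct p as [x y]. unfold dot, add, scal2, rotJ; simpl. intros E.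
  f_equal.
  - transitivity (x * (a * a + b * b)); [rewrite E|]; ring.
  - transitivity (y * (a * a + b * b)); [rewrite E|]; ring.
Qed.

Lemma dot_direction_frame (q p r : plane) :
  q <> (0, 0) ->
  dot p r = dot p (rotJ (direction q)) * dot r (rotJ (direction q)) +
            dot p (direction q) * dot r (direction q).
Proof.
  intros Hq. rewrite (direction_frame q p Hq) at 1.
  unfold dot, add, scal2; simpl. ring.
Qed.

(** * The Frenet frame *)

Lemma smooth_field_d_theta (p : field) :
  smooth_field p -> smooth_field (d_theta p).
Proof. intros [H1 H2]. split; simpl; now apply smooth_circle_Derive. Qed.

Lemma smooth_field_rotJ (p : field) :
  smooth_field p -> smooth_field (fun x => rotJ (p x)).
Proof. intros [H1 H2]. split; simpl; auto with smooth. Qed.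

Lemma smooth_field_scal2 (f : R -> R) (p : field) :
  smooth_circle f -> smooth_field p -> smooth_field (fun x => scal2 (f x) (p x)).
Proof. intros Hf [H1 H2]. split; simpl; auto with smooth. Qed.

Lemma smooth_field_add (p q : field) :
  smooth_field p -> smooth_field q -> smooth_field (fun x => add (p x) (q x)).
Proof. intros [H1 H2] [H3 H4]. split; simpl; auto with smooth. Qed.

Lemma smooth_circle_dot (p q : field) :
  smooth_field p -> smooth_field q -> smooth_circle (fun x => dot (p x) (q x)).
Proof. intros [H1 H2] [H3 H4]. unfold dot. auto with smooth. Qed.

Lemma smooth_field_is_derive (p : field) (x : R) :
  smooth_field p -> is_derive_plane p x (d_theta p x).
Proof. intros [H1 H2]. split; simpl; now apply smooth_circle_is_derive. Qed.

Lemma Emb_smooth (c : field) : Emb c -> smooth_field c.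
Proof. now intros [H _]. Qed.

Lemma Emb_immersed (c : field) (x : R) : Emb c -> d_theta c x <> (0, 0).
Proof. now intros [_ [H _]]. Qed.

Lemma speed_pos (c : field) (x : R) : Emb c -> 0 < speed c x.
Proof. intros Hc. apply norm2_pos. now apply Emb_immersed. Qed.

Lemma speed_neq_0 (c : field) (x : R) : Emb c -> speed c x <> 0.
Proof. intros Hc. generalize (speed_pos c x Hc). lra. Qed.

Lemma smooth_circle_speed (c : field) : Emb c -> smooth_circle (speed c).
Proof.
  intros Hc. apply smooth_circle_sqrt.
  - intros x. apply dot_self_pos. now apply Emb_immersed.
  - apply smooth_circle_dot; now apply smooth_field_d_theta, Emb_smooth.
Qed.

Lemma smooth_circle_inv_speed (c : field) :
  Emb c -> smooth_circle (fun x => / speed c x).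
Proof.
  intros Hc. apply smooth_circle_inv; [|now apply smooth_circle_speed].
  intros x. now apply speed_neq_0.
Qed.

Lemma smooth_field_tangent (c : field) : Emb c -> smooth_field (tangent c).
Proof.
  intros Hc. apply smooth_field_scal2; [now apply smooth_circle_inv_speed|].
  now apply smooth_field_d_theta, Emb_smooth.
Qed.

Lemma smooth_field_normal (c : field) : Emb c -> smooth_field (normal c).
Proof. intros Hc. now apply smooth_field_rotJ, smooth_field_tangent. Qed.

Lemma smooth_circle_n_comp (c u : field) :
  Emb c -> smooth_field u -> smooth_circle (n_comp c u).
Proof.
  intros Hc Hu. apply smooth_circle_dot; [exact Hu|].
  now apply smooth_field_normal.
Qed.

Lemma smooth_circle_t_comp (c u : field) :
  Emb c -> smooth_field u -> smooth_circle (t_comp c u).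
Proof.
  intros Hc Hu. apply smooth_circle_dot; [exact Hu|].
  now apply smooth_field_tangent.
Qed.

Lemma smooth_circle_curvature (c : field) : Emb c -> smooth_circle (curvature c).
Proof.
  intros Hc. apply smooth_circle_dot; [|now apply smooth_field_normal].
  apply smooth_field_scal2; [now apply smooth_circle_inv_speed|].
  now apply smooth_field_d_theta, smooth_field_tangent.
Qed.

Lemma smooth_circle_D_arc (c : field) (f : R -> R) :
  Emb c -> smooth_circle f -> smooth_circle (D_arc c f).
Proof.
  intros Hc Hf. apply smooth_circle_mult; [now apply smooth_circle_Derive|].
  now apply smooth_circle_inv_speed.
Qed.

#[export] Hint Resolve smooth_field_d_theta smooth_field_rotJ smooth_field_scal2
  smooth_field_add smooth_circle_dot Emb_smooth smooth_circle_speed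
  smooth_circle_inv_speed smooth_field_tangent smooth_field_normal
  smooth_circle_n_comp smooth_circle_t_comp smooth_circle_curvature
  smooth_circle_D_arc : smooth.

Lemma tangent_unit (c : field) (x : R) :
  Emb c -> dot (tangent c x) (tangent c x) = 1.
Proof. intros Hc. now apply dot_direction, Emb_immersed. Qed.

Lemma normal_unit (c : field) (x : R) :
  Emb c -> dot (normal c x) (normal c x) = 1.
Proof.
  intros Hc. rewrite <- (tangent_unit c x Hc).
  unfold dot, normal, rotJ; simpl. ring.
Qed.

Lemma frame_decomposition (c u : field) (x : R) :
  Emb c ->
  u x = add (scal2 (n_comp c u x) (normal c x))
            (scal2 (t_comp c u x) (tangent c x)).
Proof. intros Hc. now apply (direction_frame (d_theta c x)), Emb_immersed. Qed.

Lemma dot_frame (c u w : field) (x : R) :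
  Emb c ->
  dot (u x) (w x) = n_comp c u x * n_comp c w x + t_comp c u x * t_comp c w x.
Proof. intros Hc. now apply (dot_direction_frame (d_theta c x)), Emb_immersed. Qed.

Lemma dot_scal2_r (p q : plane) (k : R) : dot p (scal2 k q) = k * dot p q.
Proof. unfold dot, scal2; simpl. ring. Qed.

Lemma dot_scal2_l (p q : plane) (k : R) : dot (scal2 k p) q = k * dot p q.
Proof. unfold dot, scal2; simpl. ring. Qed.

Lemma dot_rotJ_scal2 (p q : plane) (k : R) :
  dot p (rotJ (scal2 k (rotJ q))) = - k * dot p q.
Proof. unfold dot, scal2, rotJ; simpl. ring. Qed.

Lemma dot_add_l (p q r : plane) : dot (add p q) r = dot p r + dot q r.
Proof. unfold dot, add; simpl. ring. Qed.

(** The Frenet equation [D_theta t = kappa n], multiplied by the speed. *)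
Lemma is_derive_tangent (c : field) (x : R) :
  Emb c ->
  is_derive_plane (tangent c) x
    (scal2 (curvature c x * speed c x) (normal c x)).
Proof.
  intros Hc.
  assert (H : is_derive_plane (tangent c) x
    (scal2 (dot (d_theta (d_theta c) x) (normal c x) / speed c x)
           (normal c x))).
  { apply (is_derive_direction (d_theta c)); [|now apply Emb_immersed].
    apply smooth_field_is_derive. auto with smooth. }
  assert (E : d_theta (tangent c) x =
    scal2 (dot (d_theta (d_theta c) x) (normal c x) / speed c x) (normal c x)).
  { destruct H as [H1 H2].
    exact (f_equal2 pair (is_derive_unique _ _ _ H1)
                         (is_derive_unique _ _ _ H2)). }
  replace (curvature c x * speed c x)
    with (dot (d_theta (d_theta c) x) (normal c x) / speed c x); [exact H|].
  unfold curvature. rewrite E, !dot_scal2_l, normal_unit by exact Hc.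
  field. now apply speed_neq_0.
Qed.

Lemma is_derive_t_comp (c u : field) (x : R) :
  Emb c -> smooth_field u ->
  is_derive (t_comp c u) x
    (t_comp c (d_theta u) x + curvature c x * speed c x * n_comp c u x).
Proof.
  intros Hc Hu. eapply is_derive_value.
  - apply is_derive_dot; [now apply smooth_field_is_derive|].
    now apply is_derive_tangent.
  - now rewrite dot_scal2_r.
Qed.

Lemma is_derive_n_comp (c u : field) (x : R) :
  Emb c -> smooth_field u ->
  is_derive (n_comp c u) x
    (n_comp c (d_theta u) x - curvature c x * speed c x * t_comp c u x).
Proof.
  intros Hc Hu. eapply is_derive_value.
  - apply is_derive_dot; [now apply smooth_field_is_derive|].
    apply is_derive_rotJ. now apply is_derive_tangent.
  - cbv beta. unfold normal at 2. rewrite dot_rotJ_scal2.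
    unfold n_comp, t_comp. ring.
Qed.

(** * Identification of covectors with functions along the curve *)

Lemma int_dl_ext (c : field) (f g : R -> R) :
  (forall x, f x = g x) -> int_dl c f = int_dl c g.
Proof. intros E. apply RInt_ext. intros x _. now rewrite E. Qed.

Lemma int_dl_plus (c : field) (f g : R -> R) :
  Emb c -> smooth_circle f -> smooth_circle g ->
  int_dl c (fun x => f x + g x) = int_dl c f + int_dl c g.
Proof.
  intros Hc Hf Hg. unfold int_dl.
  transitivity (RInt (fun x => plus (f x * speed c x) (g x * speed c x))
                  0 (2 * PI)).
  - apply RInt_ext. intros x _. unfold plus; simpl. ring.
  - apply (RInt_plus (V := R_CompleteNormedModule));
      apply smooth_circle_ex_RInt; auto with smooth.
Qed.

Lemma int_dl_scal (c : field) (k : R) (f : R -> R) :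
  Emb c -> smooth_circle f -> int_dl c (fun x => k * f x) = k * int_dl c f.
Proof.
  intros Hc Hf. unfold int_dl.
  transitivity (RInt (fun x => scal k (f x * speed c x)) 0 (2 * PI)).
  - apply RInt_ext. intros x _. unfold scal; simpl. unfold mult; simpl. ring.
  - apply (RInt_scal (V := R_CompleteNormedModule)).
    apply smooth_circle_ex_RInt; auto with smooth.
Qed.

Lemma int_dl_minus (c : field) (f g : R -> R) :
  Emb c -> smooth_circle f -> smooth_circle g ->
  int_dl c (fun x => f x - g x) = int_dl c f - int_dl c g.
Proof.
  intros Hc Hf Hg.
  rewrite (int_dl_ext c _ (fun x => f x + -1 * g x)) by (intros x; ring).
  rewrite int_dl_plus, int_dl_scal by auto with smooth. ring.
Qed.

Lemma int_dl_nonneg_zero (c : field) (f : R -> R) :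
  Emb c -> smooth_circle f -> (forall x, 0 <= f x) -> int_dl c f = 0 ->
  forall x, f x = 0.
Proof.
  intros Hc Hf Hpos H x.
  assert (Hs := speed_pos c x Hc).
  assert (E : f x * speed c x = 0).
  { revert x Hs. refine (fun x _ => nonneg_RInt_zero
      (fun y => f y * speed c y) _ _ H x).
    - auto with smooth.
    - intros y. apply Rmult_le_pos; [apply Hpos|].
      now apply Rlt_le, speed_pos. }
  apply Rmult_integral in E. destruct E; lra.
Qed.

(** The difference of the two representing fields, being smooth, may itself be
    taken as test field. *)
Lemma covector_representative_unique (c p q : field) :
  Emb c -> smooth_field p -> smooth_field q ->
  (forall w, smooth_field w ->
     int_dl c (fun x => dot (p x) (w x)) = int_dl c (fun x => dot (q x) (w x))) ->
  forall x, p x = q x.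
Proof.
  intros Hc Hp Hq H.
  pose (w := fun x => add (p x) (scal2 (-1) (q x))).
  assert (Hw : smooth_field w) by (unfold w; auto with smooth).
  assert (Z : forall x, dot (w x) (w x) = 0).
  { apply (int_dl_nonneg_zero c); auto with smooth.
    - intros x. unfold dot. nra.
    - rewrite <- (Rminus_diag_eq _ _ (H w Hw)).
      rewrite <- int_dl_minus by auto with smooth.
      apply int_dl_ext. intros x. unfold w, dot, add, scal2; simpl. ring. }
  intros x. specialize (Z x). unfold w, dot, add, scal2 in Z; simpl in Z.
  rewrite (surjective_pairing (p x)), (surjective_pairing (q x)).
  destruct (Rplus_sqr_eq_0 (fst (p x) + -1 * fst (q x))
                           (snd (p x) + -1 * snd (q x)) Z).
  f_equal; lra.
Qed.

Lemma function_representative_unique (c : field) (f g : R -> R) :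
  Emb c -> smooth_circle f -> smooth_circle g ->
  (forall k, smooth_circle k ->
     int_dl c (fun x => f x * k x) = int_dl c (fun x => g x * k x)) ->
  forall x, f x = g x.
Proof.
  intros Hc Hf Hg H.
  pose (k := fun x => f x - g x).
  assert (Hk : smooth_circle k) by (unfold k; auto with smooth).
  assert (Z : forall x, k x * k x = 0).
  { apply (int_dl_nonneg_zero c); auto with smooth.
    - intros x. nra.
    - rewrite <- (Rminus_diag_eq _ _ (H k Hk)).
      rewrite <- int_dl_minus by auto with smooth.
      apply int_dl_ext. intros x. unfold k. ring. }
  intros x. specialize (Z x). unfold k in Z. nra.
Qed.

(** * Partial derivatives of the Lagrangians *)

Lemma L_hcf_split (c u : field) :
  Emb c -> smooth_field u -> L_hcf c u = L_h c u + L_v c u.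
Proof.
  intros Hc Hu. unfold L_hcf, L_h, L_v.
  rewrite <- int_dl_plus by auto with smooth.
  apply int_dl_ext. intros x.
  replace (norm2 (u x) ^ 2) with (dot (u x) (u x))
    by (rewrite <- norm2_sqr; ring).
  rewrite (dot_frame c u u x Hc). ring.
Qed.

(** The integral is a polynomial of degree two in [e], whose linear coefficient
    is the derivative at [0]. *)
Lemma Derive_int_dl_quadratic (c : field) (f g : R -> R) (k : R) :
  Emb c -> smooth_circle f -> smooth_circle g ->
  Derive (fun e => int_dl c (fun x => / 2 * (f x + e * g x) ^ 2 + k)) 0 =
  int_dl c (fun x => f x * g x).
Proof.
  intros Hc Hf Hg.
  rewrite (Derive_ext _ (fun e => int_dl c (fun x => / 2 * f x ^ 2 + k) +
             (e * int_dl c (fun x => f x * g x) +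
              / 2 * e ^ 2 * int_dl c (fun x => g x ^ 2)))).
  - apply is_derive_unique. auto_derive; [exact I|ring].
  - intros e. rewrite <- !int_dl_scal, <- !int_dl_plus by auto 6 with smooth.
    apply int_dl_ext. intros x. field.
Qed.

Lemma dL_dct_L_h (c u w : field) :
  Emb c -> smooth_field u -> smooth_field w ->
  dL_dct L_h c u w = int_dl c (fun x => n_comp c u x * n_comp c w x).
Proof.
  intros Hc Hu Hw. rewrite <- (Derive_int_dl_quadratic c _ _ (-1))
    by auto with smooth.
  apply Derive_ext. intros e. apply int_dl_ext. intros x.
  unfold n_comp at 1. rewrite dot_add_l, dot_scal2_l. reflexivity.
Qed.

Lemma dL_dct_L_v (c u w : field) :
  Emb c -> smooth_field u -> smooth_field w ->
  dL_dct L_v c u w = int_dl c (fun x => t_comp c u x * t_comp c w x).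
Proof.
  intros Hc Hu Hw. rewrite <- (Derive_int_dl_quadratic c _ _ 0)
    by auto with smooth.
  apply Derive_ext. intros e. apply int_dl_ext. intros x.
  unfold t_comp at 1. rewrite dot_add_l, dot_scal2_l, Rplus_0_r. reflexivity.
Qed.

Definition continuity_2d_plane (q : R -> R -> plane) (e x : R) : Prop :=
  continuity_2d_pt (fun s y => fst (q s y)) e x /\
  continuity_2d_pt (fun s y => snd (q s y)) e x.

Lemma continuity_2d_plane_dot (p q : R -> R -> plane) (e x : R) :
  continuity_2d_plane p e x -> continuity_2d_plane q e x ->
  continuity_2d_pt (fun s y => dot (p s y) (q s y)) e x.
Proof.
  intros [P1 P2] [Q1 Q2].
  apply continuity_2d_pt_plus; now apply continuity_2d_pt_mult.
Qed.

Lemma continuity_2d_plane_scal2 (f : R -> R -> R) (q : R -> R -> plane) (e x : R) :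
  continuity_2d_pt f e x -> continuity_2d_plane q e x ->
  continuity_2d_plane (fun s y => scal2 (f s y) (q s y)) e x.
Proof. intros Hf [Q1 Q2]. split; simpl; now apply continuity_2d_pt_mult. Qed.

Lemma continuity_2d_plane_rotJ (q : R -> R -> plane) (e x : R) :
  continuity_2d_plane q e x ->
  continuity_2d_plane (fun s y => rotJ (q s y)) e x.
Proof.
  intros [Q1 Q2]. split; simpl; [|exact Q1]. now apply continuity_2d_pt_opp.
Qed.

Lemma continuity_2d_pt_snd (f : R -> R) (e x : R) :
  continuous f x -> continuity_2d_pt (fun _ y => f y) e x.
Proof.
  intros Hf. apply (continuity_1d_2d_pt_comp f (fun _ y => y)).
  - now apply continuity_pt_filterlim.
  - apply continuity_2d_pt_id2.
Qed.

Lemma continuity_2d_plane_field (u : field) (e x : R) :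
  smooth_field u -> continuity_2d_plane (fun _ y => u y) e x.
Proof.
  intros [H1 H2].
  split; now apply (continuity_2d_pt_snd (fun y => _ (u y)) e x),
                    smooth_circle_continuous.
Qed.

Lemma continuity_2d_pt_norm2 (q : R -> R -> plane) (e x : R) :
  continuity_2d_plane q e x ->
  continuity_2d_pt (fun s y => norm2 (q s y)) e x.
Proof.
  intros Hq. apply (continuity_1d_2d_pt_comp sqrt (fun s y => dot (q s y) (q s y))).
  - apply continuity_pt_filterlim. apply continuous_sqrt.
  - now apply continuity_2d_plane_dot.
Qed.

Lemma continuity_2d_plane_direction (q : R -> R -> plane) (e x : R) :
  continuity_2d_plane q e x -> q e x <> (0, 0) ->
  continuity_2d_plane (fun s y => direction (q s y)) e x.
Proof.
  intros Hq Hnz. apply continuity_2d_plane_scal2; [|exact Hq].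
  apply continuity_2d_pt_inv; [now apply continuity_2d_pt_norm2|].
  generalize (norm2_pos _ Hnz). lra.
Qed.

Lemma continuity_2d_pt_continuous_snd (f : R -> R -> R) (e x : R) :
  continuity_2d_pt f e x -> continuous (f e) x.
Proof.
  intros H. apply continuity_pt_filterlim.
  intros eps Heps. destruct (H (mkposreal eps Heps)) as [d Hd].
  exists d. split; [apply cond_pos|]. intros y [_ Hy].
  apply Hd; [|exact Hy]. rewrite Rminus_diag_eq, Rabs_R0 by reflexivity.
  apply cond_pos.
Qed.

Definition varied_velocity (c w : field) (e x : R) : plane :=
  add (d_theta c x) (scal2 e (d_theta w x)).

Lemma varied_velocity_0 (c w : field) (x : R) :
  varied_velocity c w 0 x = d_theta c x.
Proof.
  unfold varied_velocity. destruct (d_theta c x) as [a b].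
  unfold add, scal2; simpl. f_equal; ring.
Qed.

Lemma d_theta_variation (c w : field) (e x : R) :
  smooth_field c -> smooth_field w ->
  d_theta (fun y => add (c y) (scal2 e (w y))) x = varied_velocity c w e x.
Proof.
  intros [C1 C2] [W1 W2]. unfold d_theta, add, scal2; simpl.
  apply (f_equal2 pair); apply is_derive_unique;
    apply is_derive_Rplus; try (now apply smooth_circle_is_derive);
    apply is_derive_scal; now apply smooth_circle_is_derive.
Qed.

(** Immersions form an open set: [|c_theta|] is bounded below and [|w_theta|]
    above on the compact circle. *)
Lemma varied_velocity_neq_0 (c w : field) :
  Emb c -> smooth_field w ->
  locally 0 (fun e => forall x, 0 <= x <= 2 * PI ->
                 varied_velocity c w e x <> (0, 0)).
Proof.
  intros Hc Hw.
  assert (Hpi := PI_RGT_0).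
  assert (Cc : smooth_circle (fun x => dot (d_theta c x) (d_theta c x)))
    by auto with smooth.
  assert (Cw : smooth_circle (fun x => dot (d_theta w x) (d_theta w x)))
    by auto with smooth.
  destruct (continuity_ab_min (fun x => dot (d_theta c x) (d_theta c x))
              0 (2 * PI)) as [xm [Hm _]]; [lra| |].
  { intros x _. apply continuity_pt_filterlim.
    now apply (smooth_circle_continuous _ x Cc). }
  destruct (continuity_ab_maj (fun x => dot (d_theta w x) (d_theta w x))
              0 (2 * PI)) as [xM [HM _]]; [lra| |].
  { intros x _. apply continuity_pt_filterlim.
    now apply (smooth_circle_continuous _ x Cw). }
  assert (Hmpos := dot_self_pos _ (Emb_immersed c xm Hc)).
  assert (HMpos : 0 <= dot (d_theta w xM) (d_theta w xM)) by (unfold dot; nra).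
  set (m := dot (d_theta c xm) (d_theta c xm)) in *.
  set (M := dot (d_theta w xM) (d_theta w xM)) in *.
  assert (Hd : 0 < Rmin 1 (m / (M + 1))).
  { apply Rmin_pos; [lra|]. apply Rdiv_lt_0_compat; lra. }
  exists (mkposreal _ Hd). intros e He x Hx Hz.
  assert (He' : Rabs e < Rmin 1 (m / (M + 1))).
  { rewrite <- (Rminus_0_r e).
    exact He. }
  assert (H1 := Rlt_le_trans _ _ _ He' (Rmin_l _ _)).
  assert (H2 := Rlt_le_trans _ _ _ He' (Rmin_r _ _)).
  assert (H3 : Rabs e * (M + 1) < m).
  { apply (Rmult_lt_compat_r (M + 1)) in H2; [|lra].
    replace (m / (M + 1) * (M + 1)) with m in H2 by (field; lra). exact H2. }
  assert (H4 : Rabs e * Rabs e = e * e)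
    by (rewrite <- Rabs_mult; apply Rabs_pos_eq; nra).
  assert (H0 := Rabs_pos e).
  (* where the varied velocity vanishes, |c_theta|^2 = e^2 |w_theta|^2 *)
  assert (E : dot (d_theta c x) (d_theta c x) =
              e * e * dot (d_theta w x) (d_theta w x)).
  { injection Hz as Z1 Z2. unfold dot.
    set (a := d_theta c x) in *. set (b := d_theta w x) in *.
    replace (fst a) with (- (e * fst b)) by (simpl in *; lra).
    replace (snd a) with (- (e * snd b)) by (simpl in *; lra).
    ring. }
  specialize (Hm x Hx). specialize (HM x Hx). cbv beta in Hm, HM.
  rewrite E, <- H4 in Hm.
  assert (Rabs e * Rabs e * dot (d_theta w x) (d_theta w x)
          <= Rabs e * Rabs e * M) by (apply Rmult_le_compat_l; nra).
  assert (Rabs e * Rabs e * M <= Rabs e * M)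
    by (apply Rmult_le_compat_r; nra).
  nra.
Qed.

Definition varied_density (c u w : field) (e x : R) : R :=
  (/ 2 * dot (u x) (rotJ (direction (varied_velocity c w e x))) ^ 2 - 1) *
  norm2 (varied_velocity c w e x).

(** The derivative of [varied_density] in [e]: the first term comes from the
    rotation of the frame, the second from the growth of the speed. *)
Definition density_variation (c u w : field) (e x : R) : R :=
  let t := direction (varied_velocity c w e x) in
  - (dot (u x) (rotJ t) * dot (u x) t * dot (d_theta w x) (rotJ t)) +
  (/ 2 * dot (u x) (rotJ t) ^ 2 - 1) * dot (d_theta w x) t.

Lemma is_derive_affine (k l e : R) : is_derive (fun s => k + s * l) e l.
Proof. auto_derive; [exact I|ring]. Qed.

Lemma is_derive_varied_density (c u w : field) (e x : R) :
  varied_velocity c w e x <> (0, 0) ->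
  is_derive (fun s => varied_density c u w s x) e (density_variation c u w e x).
Proof.
  intros Hnz. assert (Hs := norm2_pos _ Hnz).
  assert (Hq : is_derive_plane (fun s => varied_velocity c w s x) e (d_theta w x)).
  { split; apply is_derive_affine. }
  assert (Hh := is_derive_dot _ _ _ _ _ (is_derive_plane_const (u x) e)
                  (is_derive_rotJ _ _ _ (is_derive_direction _ _ _ Hq Hnz))).
  assert (Hn := is_derive_norm2 _ _ _ Hq Hnz).
  cbv beta in Hh. rewrite dot_rotJ_scal2 in Hh.
  unfold varied_density. eapply is_derive_value.
  - apply is_derive_Rmult; [|exact Hn].
    apply is_derive_Rplus; [|apply (is_derive_const (V := R_NormedModule))].
    apply is_derive_scal. apply (is_derive_pow _ 2 _ _ Hh).
  - unfold density_variation, zero; simpl.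
    set (t := direction (varied_velocity c w e x)).
    replace (dot (0, 0) (rotJ t)) with 0 by (unfold dot; simpl; ring).
    field. lra.
Qed.

Lemma continuity_2d_varied_velocity (c w : field) (e x : R) :
  smooth_field c -> smooth_field w ->
  continuity_2d_plane (varied_velocity c w) e x.
Proof.
  intros Hc Hw.
  assert (Kc := continuity_2d_plane_field (d_theta c) e x
                  ltac:(auto with smooth)).
  assert (Kw := continuity_2d_plane_field (d_theta w) e x
                  ltac:(auto with smooth)).
  destruct Kc as [C1 C2].
  destruct (continuity_2d_plane_scal2 (fun s _ => s) _ e x
              (continuity_2d_pt_id1 e x) Kw) as [W1 W2].
  split; now apply continuity_2d_pt_plus.
Qed.

Lemma dL_dc_L_h_integral (c u w : field) :
  Emb c -> smooth_field u -> smooth_field w ->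
  dL_dc L_h c u w = RInt (density_variation c u w 0) 0 (2 * PI).
Proof.
  intros Hc Hu Hw.
  assert (Hpi := PI_RGT_0).
  assert (Hbox : forall x, Rmin 0 (2 * PI) <= x <= Rmax 0 (2 * PI) <->
                           0 <= x <= 2 * PI).
  { intros x. rewrite Rmin_left, Rmax_right by lra. tauto. }
  assert (Hnz := varied_velocity_neq_0 c w Hc Hw).
  assert (Hcq : forall e x, continuity_2d_plane (varied_velocity c w) e x).
  { intros e x. apply continuity_2d_varied_velocity; auto with smooth. }
  assert (Hcu : forall e x, continuity_2d_plane (fun _ y => u y) e x).
  { intros e x. now apply continuity_2d_plane_field. }
  assert (Hcw : forall e x, continuity_2d_plane (fun _ y => d_theta w y) e x).
  { intros e x. apply continuity_2d_plane_field. auto with smooth. }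
  transitivity (Derive (fun e => RInt (varied_density c u w e) 0 (2 * PI)) 0).
  { apply Derive_ext. intros e. apply RInt_ext. intros x _.
    unfold n_comp, normal, tangent, speed.
    rewrite d_theta_variation by auto with smooth. reflexivity. }
  transitivity (RInt (fun x => Derive (fun e => varied_density c u w e x) 0)
                  0 (2 * PI)).
  { apply is_derive_unique.
    apply (is_derive_RInt_param (varied_density c u w) 0 (2 * PI) 0).
    - revert Hnz. apply filter_imp. intros e He x Hx.
      eexists. apply is_derive_varied_density. apply He. now apply Hbox.
    - intros x Hx. apply Hbox in Hx.
      assert (Hx0 : varied_velocity c w 0 x <> (0, 0))
        by exact (locally_singleton _ _ Hnz x Hx).
      apply (continuity_2d_pt_ext_loc (density_variation c u w)).
      + assert (L := continuity_2d_pt_neq_0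
          (fun e y => dot (varied_velocity c w e y) (varied_velocity c w e y)) 0 x
          (continuity_2d_plane_dot _ _ _ _ (Hcq 0 x) (Hcq 0 x))
          ltac:(generalize (dot_self_pos _ Hx0); cbv beta; lra)).
        revert L. apply locally_2d_impl. apply locally_2d_forall.
        intros e y Hey. symmetry. apply is_derive_unique.
        apply is_derive_varied_density. intros Z. apply Hey. rewrite Z.
        unfold dot; simpl. ring.
      + assert (Ht := continuity_2d_plane_direction _ 0 x (Hcq 0 x) Hx0).
        assert (Hn := continuity_2d_plane_rotJ _ 0 x Ht).
        assert (Kh := continuity_2d_plane_dot _ _ 0 x (Hcu 0 x) Hn).
        unfold density_variation. apply continuity_2d_pt_plus.
        * apply continuity_2d_pt_opp.
          apply continuity_2d_pt_mult; [apply continuity_2d_pt_mult|];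
            now apply continuity_2d_plane_dot.
        * apply continuity_2d_pt_mult; [|now apply continuity_2d_plane_dot].
          apply continuity_2d_pt_minus; [|apply continuity_2d_pt_const].
          apply continuity_2d_pt_mult; [apply continuity_2d_pt_const|].
          simpl. apply continuity_2d_pt_mult; [exact Kh|].
          apply continuity_2d_pt_mult; [exact Kh|apply continuity_2d_pt_const].
    - revert Hnz. apply filter_imp. intros e He.
      apply (ex_RInt_continuous (V := R_CompleteNormedModule)).
      intros x Hx. apply Hbox in Hx. specialize (He x Hx).
      apply continuity_2d_pt_continuous_snd.
      assert (Hn := continuity_2d_plane_rotJ _ e x
                      (continuity_2d_plane_direction _ e x (Hcq e x) He)).
      assert (Kh := continuity_2d_plane_dot _ _ e x (Hcu e x) Hn).
      unfold varied_density.
      apply continuity_2d_pt_mult; [|now apply continuity_2d_pt_norm2].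
      apply continuity_2d_pt_minus; [|apply continuity_2d_pt_const].
      apply continuity_2d_pt_mult; [apply continuity_2d_pt_const|].
      simpl. apply continuity_2d_pt_mult; [exact Kh|].
      apply continuity_2d_pt_mult; [exact Kh|apply continuity_2d_pt_const]. }
  apply RInt_ext. intros x Hx. apply is_derive_unique.
  apply is_derive_varied_density. apply (locally_singleton _ _ Hnz).
  rewrite Rmin_left, Rmax_right in Hx by lra. lra.
Qed.

(** Integration by parts moves the derivative off [w].  In the tangential
    coefficient the curvature terms combine with [D_theta h] into the rotation
    rate [n . D_theta u] of the frame. *)
Lemma dL_dc_L_h (c u w : field) :
  Emb c -> smooth_field u -> smooth_field w ->
  dL_dc L_h c u w =
  int_dl c (fun x =>
    (D_arc c (fun y => t_comp c u y * n_comp c u y) x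
     - curvature c x * (/ 2 * n_comp c u x ^ 2 - 1)) * n_comp c w x
    - n_comp c u x * (n_comp c (d_theta u) x / speed c x) * t_comp c w x).
Proof.
  intros Hc Hu Hw. rewrite dL_dc_L_h_integral by assumption.
  pose (B := fun x => - (n_comp c u x * t_comp c u x * n_comp c w x) +
                      (/ 2 * n_comp c u x ^ 2 - 1) * t_comp c w x).
  assert (HB : smooth_circle B) by (unfold B; auto 7 with smooth).
  unfold int_dl.
  match goal with |- _ = RInt ?f _ _ =>
    transitivity (RInt (fun x => plus (Derive B x) (f x)) 0 (2 * PI)) end.
  - apply RInt_ext. intros x _.
    assert (Hs := speed_neq_0 c x Hc).
    assert (Dh := is_derive_n_comp c u x Hc Hu).
    assert (Dv := is_derive_t_comp c u x Hc Hu).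
    assert (Dwn := is_derive_n_comp c w x Hc Hw).
    assert (Dwt := is_derive_t_comp c w x Hc Hw).
    assert (DB : is_derive B x
      (- (((n_comp c (d_theta u) x - curvature c x * speed c x * t_comp c u x)
             * t_comp c u x +
           n_comp c u x *
             (t_comp c (d_theta u) x + curvature c x * speed c x * n_comp c u x))
          * n_comp c w x +
          n_comp c u x * t_comp c u x *
          (n_comp c (d_theta w) x - curvature c x * speed c x * t_comp c w x)) +
       (n_comp c u x *
          (n_comp c (d_theta u) x - curvature c x * speed c x * t_comp c u x)
        * t_comp c w x +
        (/ 2 * n_comp c u x ^ 2 - 1) *
        (t_comp c (d_theta w) x + curvature c x * speed c x * n_comp c w x)))).
    { unfold B. eapply is_derive_value.
      - apply is_derive_Rplus.
        + apply is_derive_Ropp.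
          apply is_derive_Rmult; [apply is_derive_Rmult|]; eassumption.
        + apply is_derive_Rmult; [|exact Dwt].
          apply is_derive_Rplus; [|apply (is_derive_const (V := R_NormedModule))].
          apply is_derive_scal. apply (is_derive_pow _ 2 _ _ Dh).
      - unfold zero; simpl. field. }
    rewrite (is_derive_unique _ _ _ DB).
    unfold D_arc.
    rewrite (is_derive_unique _ _ _ (is_derive_Rmult _ _ _ _ _ Dv Dh) :
      Derive (fun y => t_comp c u y * n_comp c u y) x = _).
    unfold plus; simpl.
    change (density_variation c u w 0 x) with
      (let t := direction (varied_velocity c w 0 x) in
       - (dot (u x) (rotJ t) * dot (u x) t * dot (d_theta w x) (rotJ t)) +
       (/ 2 * dot (u x) (rotJ t) ^ 2 - 1) * dot (d_theta w x) t).
    rewrite varied_velocity_0. cbv zeta.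
    change (direction (d_theta c x)) with (tangent c x).
    change (rotJ (tangent c x)) with (normal c x).
    change (dot (u x) (normal c x)) with (n_comp c u x).
    change (dot (u x) (tangent c x)) with (t_comp c u x).
    change (dot (d_theta w x) (normal c x)) with (n_comp c (d_theta w) x).
    change (dot (d_theta w x) (tangent c x)) with (t_comp c (d_theta w) x).
    field. exact Hs.
  - rewrite (RInt_plus (V := R_CompleteNormedModule)).
    + rewrite RInt_Derive_circle by exact HB. apply Rplus_0_l.
    + apply smooth_circle_ex_RInt. auto with smooth.
    + apply smooth_circle_ex_RInt. unfold Rdiv. auto 12 with smooth.
Qed.

(** * Evolution of the frame along a curve of embeddings *)

Lemma smooth2_dt (D : R -> Prop) (f : R -> R -> R) :
  smooth2 D f -> smooth2 D (fun t x => Derive (fun s => f s x) t).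
Proof. intros Hf k. exact (proj1 (proj2 (proj2 (Hf (S k))))). Qed.

Lemma smooth2_dx (D : R -> Prop) (f : R -> R -> R) :
  smooth2 D f -> smooth2 D (fun t x => Derive (f t) x).
Proof. intros Hf k. exact (proj2 (proj2 (proj2 (Hf (S k))))). Qed.

Lemma smooth2_ex_derive (D : R -> Prop) (f : R -> R -> R) (t x : R) :
  smooth2 D f -> D t ->
  ex_derive (fun s => f s x) t /\ ex_derive (f t) x.
Proof. intros Hf Ht. exact (proj1 (proj2 (Hf 1%nat)) t x Ht). Qed.

Lemma smooth2_slice (D : R -> Prop) (f : R -> R -> R) (t : R) :
  smooth2 D f -> D t -> smooth (f t).
Proof.
  intros Hf Ht. apply smooth_differentiable_upto. intros n. revert f Hf.
  induction n as [|n IH]; intros f Hf; [exact I|]. split.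
  - intros x. now apply (smooth2_ex_derive D).
  - exact (IH _ (smooth2_dx D f Hf)).
Qed.

Lemma smooth2_Schwarz (D : R -> Prop) (f : R -> R -> R) (t x : R) :
  open D -> smooth2 D f -> D t ->
  Derive (fun s => Derive (f s) x) t =
  Derive (fun y => Derive (fun s => f s y) t) x.
Proof.
  intros HD Hf Ht.
  assert (Ft := smooth2_dt D f Hf). assert (Fx := smooth2_dx D f Hf).
  apply Schwarz.
  - destruct (HD t Ht) as [eps He]. exists eps. intros s y Hs _.
    assert (Ds : D s) by exact (He s Hs).
    repeat split.
    + now apply (smooth2_ex_derive D).
    + now apply (smooth2_ex_derive D).
    + now apply (smooth2_ex_derive D _ s y Fx).
    + now apply (smooth2_ex_derive D _ s y Ft).
  - exact (proj1 (smooth2_dt D _ Fx O) t x Ht).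
  - exact (proj1 (smooth2_dx D _ Ft O) t x Ht).
Qed.

(** Smooth curves in [C^oo(S^1, R^2)]: unlike [curve_in_Emb], this class is
    stable under the time derivative, hence contains [c_t] and [c_tt]. *)
Definition smooth_curve (D : R -> Prop) (p : R -> field) : Prop :=
  smooth2 D (fun t x => fst (p t x)) /\ smooth2 D (fun t x => snd (p t x)) /\
  forall t x, D t -> p t (x + 2 * PI) = p t x.

Lemma curve_in_Emb_smooth_curve (D : R -> Prop) (c : R -> field) :
  curve_in_Emb D c -> smooth_curve D c.
Proof.
  intros [H1 [H2 H3]]. split; [exact H1|]. split; [exact H2|].
  intros t x Ht. destruct (Emb_smooth _ (H3 t Ht)) as [[_ P1] [_ P2]].
  rewrite (surjective_pairing (c t x)), (surjective_pairing (c t (x + 2 * PI))).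
  now rewrite P1, P2.
Qed.

Lemma smooth_curve_dt (D : R -> Prop) (p : R -> field) :
  open D -> smooth_curve D p -> smooth_curve D (d_t p).
Proof.
  intros HD [H1 [H2 H3]].
  split; [exact (smooth2_dt D _ H1)|]. split; [exact (smooth2_dt D _ H2)|].
  intros t x Ht. unfold d_t.
  apply (f_equal2 pair); apply Derive_ext_loc;
    (apply (filter_imp D); [|exact (HD t Ht)]); intros s Hs; now rewrite H3.
Qed.

Lemma smooth_curve_slice (D : R -> Prop) (p : R -> field) (t : R) :
  smooth_curve D p -> D t -> smooth_field (p t).
Proof.
  intros [H1 [H2 H3]] Ht.
  split; split;
    first [ exact (smooth2_slice D _ t H1 Ht)
          | exact (smooth2_slice D _ t H2 Ht)
          | intros x; now rewrite H3 ].
Qed.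

Lemma smooth_curve_is_derive (D : R -> Prop) (p : R -> field) (t x : R) :
  smooth_curve D p -> D t -> is_derive_plane (fun s => p s x) t (d_t p t x).
Proof.
  intros [H1 [H2 _]] Ht.
  split; apply Derive_correct;
    first [ exact (proj1 (smooth2_ex_derive D _ t x H1 Ht))
          | exact (proj1 (smooth2_ex_derive D _ t x H2 Ht)) ].
Qed.

(** Equality of mixed derivatives, [(p_theta)_t = (p_t)_theta]. *)
Lemma smooth_curve_is_derive_d_theta (D : R -> Prop) (p : R -> field) (t x : R) :
  open D -> smooth_curve D p -> D t ->
  is_derive_plane (fun s => d_theta (p s) x) t (d_theta (d_t p t) x).
Proof.
  intros HD [H1 [H2 _]] Ht.
  split; unfold d_theta, d_t; cbn [fst snd].
  - rewrite <- (smooth2_Schwarz D _ t x HD H1 Ht). apply Derive_correct.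
    exact (proj1 (smooth2_ex_derive D _ t x (smooth2_dx D _ H1) Ht)).
  - rewrite <- (smooth2_Schwarz D _ t x HD H2 Ht). apply Derive_correct.
    exact (proj1 (smooth2_ex_derive D _ t x (smooth2_dx D _ H2) Ht)).
Qed.

(** The quantity [n . D c_t], which is the angular velocity at which the frame
    turns when [theta] is held fixed. *)
Definition rotation_rate (c : R -> field) (t x : R) : R :=
  n_comp (c t) (d_theta (d_t c t)) x / speed (c t) x.

Section Evolution.

Context (D : R -> Prop) (c : R -> field).
Hypothesis HD : open D.
Hypothesis Hc : curve_in_Emb D c.

Lemma curve_Emb (t : R) : D t -> Emb (c t).
Proof. exact (proj2 (proj2 Hc) t). Qed.

Lemma velocity_smooth_curve : smooth_curve D (d_t c).
Proof. now apply smooth_curve_dt, curve_in_Emb_smooth_curve. Qed.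

Lemma velocity_smooth_field (t : R) : D t -> smooth_field (d_t c t).
Proof. apply smooth_curve_slice. exact velocity_smooth_curve. Qed.

Lemma acceleration_smooth_field (t : R) : D t -> smooth_field (d_t (d_t c) t).
Proof.
  apply smooth_curve_slice.
  exact (smooth_curve_dt D _ HD velocity_smooth_curve).
Qed.

Lemma is_derive_t_tangent (t x : R) :
  D t ->
  is_derive_plane (fun s => tangent (c s) x) t
    (scal2 (rotation_rate c t x) (normal (c t) x)).
Proof.
  intros Ht. apply (is_derive_direction (fun s => d_theta (c s) x)).
  - apply (smooth_curve_is_derive_d_theta D); auto.
    now apply curve_in_Emb_smooth_curve.
  - now apply Emb_immersed, curve_Emb.
Qed.

Lemma is_derive_h_comp (t x : R) :
  D t ->
  is_derive (fun s => h_comp c s x) t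
    (n_comp (c t) (d_t (d_t c) t) x - rotation_rate c t x * v_comp c t x).
Proof.
  intros Ht. eapply is_derive_value.
  - apply is_derive_dot.
    + exact (smooth_curve_is_derive D _ t x velocity_smooth_curve Ht).
    + apply is_derive_rotJ. now apply is_derive_t_tangent.
  - cbv beta. unfold normal at 2. rewrite dot_rotJ_scal2.
    unfold n_comp, v_comp, t_comp. ring.
Qed.

Lemma is_derive_v_comp (t x : R) :
  D t ->
  is_derive (fun s => v_comp c s x) t
    (t_comp (c t) (d_t (d_t c) t) x + rotation_rate c t x * h_comp c t x).
Proof.
  intros Ht. eapply is_derive_value.
  - apply is_derive_dot.
    + exact (smooth_curve_is_derive D _ t x velocity_smooth_curve Ht).
    + now apply is_derive_t_tangent.
  - cbv beta. rewrite dot_scal2_r. reflexivity.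
Qed.

Lemma smooth_circle_h_comp (t : R) : D t -> smooth_circle (h_comp c t).
Proof.
  intros Ht. apply smooth_circle_n_comp;
    [now apply curve_Emb|now apply velocity_smooth_field].
Qed.

Lemma smooth_circle_v_comp (t : R) : D t -> smooth_circle (v_comp c t).
Proof.
  intros Ht. apply smooth_circle_t_comp;
    [now apply curve_Emb|now apply velocity_smooth_field].
Qed.

Lemma smooth_circle_rotation_rate (t : R) :
  D t -> smooth_circle (rotation_rate c t).
Proof.
  intros Ht. assert (He := curve_Emb t Ht).
  assert (Hu := velocity_smooth_field t Ht).
  unfold rotation_rate, Rdiv. auto with smooth.
Qed.

Lemma smooth_circle_dt_h_comp (t : R) :
  D t -> smooth_circle (fun x => Derive (fun s => h_comp c s x) t).
Proof.
  intros Ht. eapply smooth_circle_ext.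
  - intros x. symmetry. apply is_derive_unique. now apply is_derive_h_comp.
  - assert (He := curve_Emb t Ht). assert (Ha := acceleration_smooth_field t Ht).
    assert (Hv := smooth_circle_v_comp t Ht).
    assert (Hr := smooth_circle_rotation_rate t Ht). auto with smooth.
Qed.

Lemma smooth_circle_dt_v_comp (t : R) :
  D t -> smooth_circle (fun x => Derive (fun s => v_comp c s x) t).
Proof.
  intros Ht. eapply smooth_circle_ext.
  - intros x. symmetry. apply is_derive_unique. now apply is_derive_v_comp.
  - assert (He := curve_Emb t Ht). assert (Ha := acceleration_smooth_field t Ht).
    assert (Hh := smooth_circle_h_comp t Ht).
    assert (Hr := smooth_circle_rotation_rate t Ht). auto with smooth.
Qed.

(** * The horizontal equation *)

(** The field [h n] representing the fibre derivative of [L_h]. *)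
Definition horizontal_momentum (t x : R) : plane :=
  scal2 (h_comp c t x) (normal (c t) x).

Lemma horizontal_momentum_smooth (t : R) :
  D t -> smooth_field (horizontal_momentum t).
Proof.
  intros Ht. apply smooth_field_scal2; [now apply smooth_circle_h_comp|].
  now apply smooth_field_normal, curve_Emb.
Qed.

Lemma is_derive_horizontal_momentum (t x : R) :
  D t ->
  is_derive_plane (fun s => horizontal_momentum s x) t
    (add (scal2 (Derive (fun s => h_comp c s x) t) (normal (c t) x))
         (scal2 (h_comp c t x)
            (rotJ (scal2 (rotation_rate c t x) (normal (c t) x))))).
Proof.
  intros Ht.
  apply (is_derive_scal2 (fun s => h_comp c s x) (fun s => normal (c s) x)).
  - apply Derive_correct. eexists. now apply is_derive_h_comp.
  - apply is_derive_rotJ. now apply is_derive_t_tangent.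
Qed.

Lemma d_t_horizontal_momentum (t x : R) :
  D t ->
  d_t horizontal_momentum t x =
    add (scal2 (Derive (fun s => h_comp c s x) t) (normal (c t) x))
        (scal2 (h_comp c t x)
           (rotJ (scal2 (rotation_rate c t x) (normal (c t) x)))).
Proof.
  intros Ht. destruct (is_derive_horizontal_momentum t x Ht) as [H1 H2].
  exact (f_equal2 pair (is_derive_unique _ _ _ H1) (is_derive_unique _ _ _ H2)).
Qed.

Lemma dL_dct_L_h_momentum (t : R) (w : field) :
  D t -> smooth_field w ->
  dL_dct L_h (c t) (d_t c t) w =
  int_dl (c t) (fun x => dot (horizontal_momentum t x) (w x)).
Proof.
  intros Ht Hw.
  rewrite dL_dct_L_h by auto using curve_Emb, velocity_smooth_field.
  apply int_dl_ext. intros x. unfold horizontal_momentum.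
  rewrite dot_scal2_l. unfold n_comp at 2, dot, h_comp. ring.
Qed.

Definition horizontal_residual (t x : R) : R :=
  D_arc (c t) (fun y => v_comp c t y * h_comp c t y) x
  - curvature (c t) x * (/ 2 * h_comp c t x ^ 2 - 1)
  - Derive (fun s => h_comp c s x) t.

Lemma horizontal_residual_smooth (t : R) :
  D t -> smooth_circle (horizontal_residual t).
Proof.
  intros Ht. assert (He := curve_Emb t Ht).
  assert (Hh := smooth_circle_h_comp t Ht).
  assert (Hv := smooth_circle_v_comp t Ht).
  assert (Hd := smooth_circle_dt_h_comp t Ht).
  unfold horizontal_residual. auto 8 with smooth.
Qed.

(** The Euler-Lagrange covector has no tangential part.  This reflects the
    invariance of [L_h] under reparametrization, which makes the tangential part
    of its derivative in [c] equal to [- h (n . D u)], and the orthogonality of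
    [h n] to [c_theta], which gives the same tangential part to [(h n)_t]. *)
Lemma EL_L_h (t : R) (w : field) :
  D t -> smooth_field w ->
  dL_dc L_h (c t) (d_t c t) w -
    int_dl (c t) (fun x => dot (d_t horizontal_momentum t x) (w x)) =
  int_dl (c t) (fun x => horizontal_residual t x * n_comp (c t) w x).
Proof.
  intros Ht Hw. assert (He := curve_Emb t Ht).
  assert (Hu := velocity_smooth_field t Ht).
  assert (Hh := smooth_circle_h_comp t Ht).
  assert (Hd := smooth_circle_dt_h_comp t Ht).
  assert (Hr := smooth_circle_rotation_rate t Ht).
  rewrite dL_dc_L_h by assumption.
  rewrite (int_dl_ext (c t) (fun x => dot (d_t horizontal_momentum t x) (w x))
    (fun x => Derive (fun s => h_comp c s x) t * n_comp (c t) w x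
              - h_comp c t x * rotation_rate c t x * t_comp (c t) w x)).
  2: { intros x. rewrite d_t_horizontal_momentum by exact Ht.
       rewrite dot_add_l, !dot_scal2_l. unfold normal at 2.
       unfold n_comp, t_comp, normal, dot, rotJ, scal2; simpl. ring. }
  rewrite <- int_dl_minus.
  - apply int_dl_ext. intros x.
    unfold horizontal_residual, rotation_rate, h_comp, v_comp. ring.
  - exact He.
  - unfold Rdiv. auto 12 with smooth.
  - auto 8 with smooth.
Qed.

Lemma is_EL_L_h_iff :
  is_EL D L_h c (fun _ _ => 0) <->
  forall t x, D t -> horizontal_residual t x = 0.
Proof.
  split.
  - intros [beta [[p [Hp Hdp]] HEL]] t x Ht.
    assert (Ep : forall s y, D s -> p s y = horizontal_momentum s y).
    { intros s y Hs. destruct (Hp s Hs) as [Sp Rp].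
      revert y. apply (covector_representative_unique (c s)).
      - now apply curve_Emb.
      - exact Sp.
      - now apply horizontal_momentum_smooth.
      - intros w Hw. rewrite <- (Rp w Hw). now apply dL_dct_L_h_momentum. }
    assert (Edp : forall y, d_t p t y = d_t horizontal_momentum t y).
    { intros y. unfold d_t.
      apply (f_equal2 pair); apply Derive_ext_loc;
        (apply (filter_imp D); [|exact (HD t Ht)]);
        intros s Hs; now rewrite Ep. }
    assert (He := curve_Emb t Ht).
    revert x. apply (function_representative_unique (c t) _ (fun _ => 0));
      [exact He|now apply horizontal_residual_smooth|auto with smooth|].
    intros k Hk.
    (* test against the horizontal variation [k n] *)
    pose (w := fun x => scal2 (k x) (normal (c t) x)).
    assert (Hw : smooth_field w) by (unfold w; auto with smooth).
    assert (Ew : forall x, n_comp (c t) w x = k x).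
    { intros x. unfold n_comp, w.
      rewrite dot_scal2_l, normal_unit by exact He. ring. }
    transitivity (int_dl (c t)
      (fun x => horizontal_residual t x * n_comp (c t) w x)).
    { apply int_dl_ext. intros x. now rewrite Ew. }
    rewrite <- EL_L_h by assumption.
    rewrite <- (int_dl_ext (c t) (fun x => dot (d_t p t x) (w x)))
      by (intros x; now rewrite Edp).
    rewrite <- (proj2 (Hdp t Ht) w Hw), <- (HEL t w Ht Hw).
    rewrite int_dl_scal by auto with smooth. ring.
  - intros H0.
    exists (fun t w => int_dl (c t)
                 (fun x => dot (d_t horizontal_momentum t x) (w x))).
    split.
    + exists horizontal_momentum. split.
      * intros t Ht. split; [now apply horizontal_momentum_smooth|].
        intros w Hw. now apply dL_dct_L_h_momentum.
      * intros t Ht. split; [|reflexivity].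
        intros x. destruct (is_derive_horizontal_momentum t x Ht) as [H1 H2].
        split; eexists; eassumption.
    + intros t w Ht Hw. rewrite EL_L_h by assumption.
      rewrite (int_dl_ext _ _ (fun x => 0 * n_comp (c t) w x))
        by (intros x; now rewrite H0).
      rewrite int_dl_scal by (auto using curve_Emb with smooth). ring.
Qed.

(** * The vertical equation *)

Lemma t_comp_generator (q : field) (xi : R -> R) (x : R) :
  Emb q -> t_comp q (generator q xi) x = xi x * speed q x.
Proof.
  intros Hq. unfold t_comp, generator.
  rewrite dot_scal2_l. unfold tangent. rewrite dot_scal2_r.
  rewrite <- norm2_sqr. fold (speed q x). field. now apply speed_neq_0.
Qed.

Lemma smooth_field_generator (q : field) (xi : R -> R) :
  Emb q -> smooth_circle xi -> smooth_field (generator q xi).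
Proof. intros Hq Hxi. unfold generator. auto with smooth. Qed.

(** A prescribed tangential component [k] is attained by the generator of
    [k / |c_theta|]; this is how elements of [g*] and vertical covectors are
    read as functions along the curve. *)
Lemma t_comp_generator_div_speed (q : field) (k : R -> R) (x : R) :
  Emb q -> t_comp q (generator q (fun y => k y / speed q y)) x = k x.
Proof.
  intros Hq. rewrite t_comp_generator by exact Hq. field.
  now apply speed_neq_0.
Qed.

Lemma smooth_circle_div_speed (q : field) (k : R -> R) :
  Emb q -> smooth_circle k -> smooth_circle (fun x => k x / speed q x).
Proof. intros Hq Hk. unfold Rdiv. auto with smooth. Qed.

Lemma momentum_map_L_v (t : R) (xi : R -> R) :
  D t -> smooth_circle xi ->
  momentum_map (c t) (dL_dct L_v (c t) (d_t c t)) xi =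
  int_dl (c t) (fun x => v_comp c t x * t_comp (c t) (generator (c t) xi) x).
Proof.
  intros Ht Hxi. apply dL_dct_L_v;
    auto using curve_Emb, velocity_smooth_field, smooth_field_generator.
Qed.

Lemma vertical_equation_iff (F : vertical_force) :
  (exists nu : R -> gstar,
     is_ddt_gstar D c
       (fun t => momentum_map (c t) (dL_dct L_v (c t) (d_t c t))) nu /\
     forall t w, D t -> vertical (c t) w ->
       connection_dual (c t) (nu t) w = force F (c t) (d_t c t) w) <->
  forall t x, D t ->
    Derive (fun s => v_comp c s x) t = force_coeff F (c t) (d_t c t) x.
Proof.
  split.
  - intros [nu [[m [Hm Hdm]] Hnu]] t x Ht.
    assert (Em : forall s y, D s -> m s y = v_comp c s y).
    { intros s y Hs. assert (He := curve_Emb s Hs).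
      destruct (Hm s Hs) as [Sm Rm].
      revert y. apply (function_representative_unique (c s));
        [exact He|exact Sm|now apply smooth_circle_v_comp|].
      intros k Hk.
      assert (Hxi := smooth_circle_div_speed (c s) k He Hk).
      assert (E := Rm _ Hxi). rewrite momentum_map_L_v in E by assumption.
      rewrite (int_dl_ext (c s) (fun y => m s y * k y)
        (fun y => m s y * t_comp (c s)
           (generator (c s) (fun y => k y / speed (c s) y)) y))
        by (intros y; now rewrite t_comp_generator_div_speed).
      rewrite <- E. apply int_dl_ext. intros y.
      now rewrite t_comp_generator_div_speed. }
    assert (Edm : forall y,
      Derive (fun s => m s y) t = Derive (fun s => v_comp c s y) t).
    { intros y. apply Derive_ext_loc.
      apply (filter_imp D); [|exact (HD t Ht)]. intros s Hs. now apply Em. }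
    assert (He := curve_Emb t Ht).
    revert x. apply (function_representative_unique (c t));
      [exact He|now apply smooth_circle_dt_v_comp| |].
    { apply force_smooth; [exact He|now apply velocity_smooth_field]. }
    intros k Hk.
    (* test against the vertical variation [k t] *)
    pose (w := fun x => scal2 (k x) (tangent (c t) x)).
    assert (Hw : smooth_field w) by (unfold w; auto with smooth).
    assert (Ew : forall x, t_comp (c t) w x = k x).
    { intros x. unfold t_comp, w.
      rewrite dot_scal2_l, tangent_unit by exact He. ring. }
    assert (Vw : vertical (c t) w).
    { split; [exact Hw|]. intros x. unfold vertical_part. now rewrite Ew. }
    assert (E := Hnu t w Ht Vw). unfold connection_dual in E.
    rewrite (proj2 (Hdm t Ht)) in E.
    2: { apply smooth_circle_div_speed; auto with smooth. }
    unfold force, connection in E.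
    rewrite (int_dl_ext (c t) (fun x => force_coeff F (c t) (d_t c t) x * k x)
      (fun x => force_coeff F (c t) (d_t c t) x * t_comp (c t) w x))
      by (intros x; now rewrite Ew).
    rewrite <- E. apply int_dl_ext. intros x.
    now rewrite t_comp_generator_div_speed, Ew, Edm by exact He.
  - intros HF.
    exists (fun t xi => int_dl (c t)
      (fun x => Derive (fun s => v_comp c s x) t *
                t_comp (c t) (generator (c t) xi) x)).
    split.
    + exists (v_comp c). split.
      * intros t Ht. split; [now apply smooth_circle_v_comp|].
        intros xi Hxi. now apply momentum_map_L_v.
      * intros t Ht. split; [|reflexivity].
        intros x. eexists. now apply is_derive_v_comp.
    + intros t w Ht Vw. apply int_dl_ext. intros x.
      unfold connection.
      rewrite t_comp_generator_div_speed by now apply curve_Emb.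
      now rewrite HF.
Qed.

Lemma unreduced_equations_iff (F : vertical_force) :
  unreduced_equations D L_h L_v F c <->
  forall t x, D t ->
    Derive (fun s => h_comp c s x) t =
      D_arc (c t) (fun y => v_comp c t y * h_comp c t y) x
      - curvature (c t) x * (/ 2 * h_comp c t x ^ 2 - 1) /\
    Derive (fun s => v_comp c s x) t = force_coeff F (c t) (d_t c t) x.
Proof.
  unfold unreduced_equations.
  rewrite is_EL_L_h_iff, (vertical_equation_iff F).
  split.
  - intros [H1 H2] t x Ht. specialize (H1 t x Ht).
    unfold horizontal_residual in H1. split; [lra|now apply H2].
  - intros H. split; intros t x Ht; destruct (H t x Ht) as [H1 H2];
      [|exact H2].
    unfold horizontal_residual. lra.
Qed.

End Evolution.

(** * The un-reduced equations of hyperbolic curvature flow *)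

Lemma open_time_interval (a b : Rbar) : open (time_interval a b).
Proof. apply open_and; [apply open_Rbar_gt|apply open_Rbar_lt]. Qed.

Lemma time_interval_convex (a b : Rbar) (s t r : R) :
  time_interval a b s -> time_interval a b t -> s <= r <= t ->
  time_interval a b r.
Proof.
  intros [Hs _] [_ Ht] [H1 H2]. split.
  - now apply (Rbar_lt_le_trans a s r).
  - now apply (Rbar_le_lt_trans r t b).
Qed.

Lemma is_derive_zero_time_interval (a b : Rbar) (f : R -> R) (s t : R) :
  (forall r, time_interval a b r -> is_derive f r 0) ->
  time_interval a b s -> time_interval a b t -> f s = f t.
Proof.
  intros Hf.
  assert (Hlt : forall s t, time_interval a b s -> time_interval a b t ->
                            s < t -> f s = f t).
  { intros s' t' Hs Ht Hst.
    apply (eq_is_derive (V := R_NormedModule) f s' t'); [|exact Hst].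
    intros r Hr. apply Hf. now apply (time_interval_convex a b s' t'). }
  intros Hs Ht. destruct (Rtotal_order s t) as [H|[->|H]]; auto.
  symmetry. now apply Hlt.
Qed.

Theorem proposition4p5 :
  (forall c u : field, Emb c -> smooth_field u ->
     L_hcf c u = L_h c u + L_v c u) /\
  (forall (a b : Rbar) (F : vertical_force) (c : R -> field),
     curve_in_Emb (time_interval a b) c ->
     (unreduced_equations (time_interval a b) L_h L_v F c <->
      forall t x : R, time_interval a b t ->
        Derive (fun s => h_comp c s x) t =
          D_arc (c t) (fun y => v_comp c t y * h_comp c t y) x
          - curvature (c t) x * (/ 2 * h_comp c t x ^ 2 - 1) /\
        Derive (fun s => v_comp c s x) t = force_coeff F (c t) (d_t c t) x /\
        d_t c t x = add (scal2 (h_comp c t x) (normal (c t) x))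
                        (scal2 (v_comp c t x) (tangent (c t) x))) /\
     ((forall q u : field, Emb q -> smooth_field u ->
         forall x : R, force_coeff F q u x = 0) ->
      unreduced_equations (time_interval a b) L_h L_v F c ->
      time_interval a b 0 ->
      (forall x : R, v_comp c 0 x = 0) ->
      forall t x : R, time_interval a b t ->
        v_comp c t x = 0 /\
        Derive (fun s => h_comp c s x) t =
          - (/ 2 * h_comp c t x ^ 2 - 1) * curvature (c t) x)).
Proof.
  split; [exact L_hcf_split|].
  intros a b F c Hc. assert (HD := open_time_interval a b).
  rewrite (unreduced_equations_iff _ c HD Hc F). split.
  - split.
    + intros H t x Ht. destruct (H t x Ht) as [H1 H2].
      split; [exact H1|]. split; [exact H2|].
      apply frame_decomposition. now apply (curve_Emb _ c Hc).
    + intros H t x Ht. destruct (H t x Ht) as [H1 [H2 _]]. now split.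
  - intros HF H H0 Hv0.
    assert (Hv : forall t x, time_interval a b t -> v_comp c t x = 0).
    { intros t x Ht. rewrite <- (Hv0 x).
      apply (is_derive_zero_time_interval a b (fun s => v_comp c s x));
        [|exact Ht|exact H0].
      intros s Hs.
      assert (E : Derive (fun s => v_comp c s x) s = 0).
      { rewrite (proj2 (H s x Hs)). apply HF; [now apply (curve_Emb _ c Hc)|].
        now apply (velocity_smooth_field _ c HD Hc). }
      rewrite <- E. apply Derive_correct. eexists.
      now apply (is_derive_v_comp _ c HD Hc). }
    intros t x Ht. split; [now apply Hv|].
    rewrite (proj1 (H t x Ht)). unfold D_arc.
    rewrite (Derive_ext (fun y => v_comp c t y * h_comp c t y) (fun _ => 0))
      by (intros y; rewrite Hv by exact Ht; ring).
    rewrite Derive_const. unfold Rdiv. ring.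
Qed.
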